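(* The exponentiation map $\exp\colon(0,\infty)\times\mathbb{R}\rightarrow(0,\infty)$, $(x,\zeta)\mapsto x^\zeta$, on Dedekind reals satisfies the base product law: for all $x,y\in(0,\infty)$ and $\zeta\in\mathbb{R}$, $$(x\cdot y)^{\zeta}=x^{\zeta}\cdot y^{\zeta},\qquad 1^{\zeta}=1.$$
   Context: All spaces are point-free and the development is geometric (constructive): spaces are localic (the category of spaces is the opposite of the category of frames), points are generalised points, and equations of points express equalities of maps. A Dedekind real (point of $\mathbb{R}$) is a pair $x=(L_x,R_x)$ of subsets of $\mathbb{Q}$ (write $q<x$ for $q\in L_x$, $x<r$ for $r\in R_x$) such that both are inhabited; $q\in L_x$ iff there is $q'>q$ with $q'\in L_x$; $r\in R_x$ iff there is $r'<r$ with $r'\in R_x$; $q\in L_x$ and $r\in R_x$ imply $q<r$; and $q<r$ implies $q\in L_x$ or $r\in R_x$. $(0,\infty)$ is the open subspace $0<x$; $(0,1]$ is the closed complement of $(1,\infty)$ in $(0,\infty)$, and $[1,\infty)$ the closed complement of $(-\infty,1)$. Arithmetic operations are the usual ones. Rational powers of $x\in(0,\infty)$: $x^a$ ($a\in\mathbb{N}$) by repeated multiplication, $x^{1/b}$ ($b\ge1$) the unique positive Dedekind real with $b$-th power $x$, $x^{a/b}=(x^a)^{1/b}$, and $x^{q}=(x^{-q})^{-1}$ for $q\le 0$. Real powers: for $x\in[1,\infty)$ and $\zeta\in\mathbb{R}$, $x^\zeta$ is the Dedekind real with $$q<x^{\zeta}\Leftrightarrow\exists q'\in\mathbb{Q}.(q'<\zeta\land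 q<x^{q'}),\qquad q>x^{\zeta}\Leftrightarrow\exists q'\in\mathbb{Q}.(q'>\zeta\land q>x^{q'}).$$ For $x\in(0,1]$, $x^{\zeta}:=(x^{-1})^{-\zeta}$. The two agree at $x=1$, and $(0,\infty)$ is the pushout of $(0,1]$ and $[1,\infty)$ over $\{1\}$, so they glue to the map $\exp\colon(0,\infty)\times\mathbb{R}\to(0,\infty)$. *)

(* Defs.v *)
From mathcomp Require Import all_boot all_order all_algebra.
From mathcomp Require Import ring lra.
From Stdlib Require Import FunctionalExtensionality ProofIrrelevance.

Set Implicit Arguments.
Unset Strict Implicit.
Unset Printing Implicit Defensive.

Import Order.TTheory GRing.Theory Num.Theory.
Local Open Scope ring_scope.

Declare Scope frame_scope.
Delimit Scope frame_scope with F.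

(* The frame of opens of a space, with joins of arbitrary subsets; no
   decidability is assumed, so that the order is valued in Prop. *)
Record frame := Frame {
  fcar :> Type;
  fle : fcar -> fcar -> Prop;
  ftop : fcar;
  fmeet : fcar -> fcar -> fcar;
  fsup : (fcar -> Prop) -> fcar;
  fle_refl : forall a, fle a a;
  fle_trans : forall b a c, fle a b -> fle b c -> fle a c;
  fle_anti : forall a b, fle a b -> fle b a -> a = b;
  fle_top : forall a, fle a ftop;
  fmeet_lel : forall a b, fle (fmeet a b) a;
  fmeet_ler : forall a b, fle (fmeet a b) b;
  fle_meet : forall a b c, fle c a -> fle c b -> fle c (fmeet a b);
  fsup_ub : forall (S : fcar -> Prop) a, S a -> fle a (fsup S);
  fsup_lub : forall (S : fcar -> Prop) c,
    (forall a, S a -> fle a c) -> fle (fsup S) c;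
  fmeet_sup : forall a (S : fcar -> Prop),
    fle (fmeet a (fsup S)) (fsup (fun c => exists2 b, S b & c = fmeet a b))
}.
Arguments ftop {f}.
Arguments fle_trans {f} b {a c}.

Definition fbot {O : frame} : O := fsup (fun _ => False).
Definition fcup {O : frame} (a b : O) : O := fsup (fun c => c = a \/ c = b).
Definition fjoin {O : frame} {I : Type} (P : I -> Prop) (A : I -> O) : O :=
  fsup (fun c => exists2 i, P i & c = A i).

Notation "a ⊑ b" := (fle a b) (at level 70, no associativity) : frame_scope.
Notation "a ⊓ b" := (fmeet a b) (at level 40, left associativity) : frame_scope.
Notation "a ⊔ b" := (fcup a b) (at level 50, left associativity) : frame_scope.
Notation "⊤" := ftop : frame_scope.
Notation "⊥" := fbot : frame_scope.
Notation "'⋁_' ( i | P ) A" := (fjoin (fun i => P : Prop) (fun i => A))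
  (at level 35, i pattern, P at level 100, A at level 36) : frame_scope.
Local Open Scope frame_scope.

(* Rules of geometric logic in the forcing style: [u ⊑ a] reads "a holds at
   stage u", and eliminating a join or a disjunction passes to a smaller
   stage. *)
Section FrameTheory.
Variable O : frame.
Implicit Types a b c u v : O.

Lemma fbotE u c : u ⊑ ⊥ -> u ⊑ c.
Proof. by move=> h; apply: (fle_trans _ h); apply: fsup_lub. Qed.

Lemma fjoinI I (P : I -> Prop) (A : I -> O) i u :
  P i -> u ⊑ A i -> u ⊑ fjoin P A.
Proof. by move=> Pi h; apply: (fle_trans _ h); apply: fsup_ub; exists i. Qed.

Lemma fjoinE I (P : I -> Prop) (A : I -> O) u c :
  u ⊑ fjoin P A -> (forall i v, v ⊑ u -> P i -> v ⊑ A i -> v ⊑ c) -> u ⊑ c.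
Proof.
move=> h k; apply: (fle_trans _ (fle_meet (fle_refl u) h)).
apply: (fle_trans _ (fmeet_sup _ _)); apply: fsup_lub => _ [_ [i Pi ->] ->].
by apply: (k i) => //; [apply: fmeet_lel|apply: fmeet_ler].
Qed.

Lemma fcupl a b u : u ⊑ a -> u ⊑ a ⊔ b.
Proof. by move=> h; apply: (fle_trans _ h); apply: fsup_ub; left. Qed.

Lemma fcupr a b u : u ⊑ b -> u ⊑ a ⊔ b.
Proof. by move=> h; apply: (fle_trans _ h); apply: fsup_ub; right. Qed.

Lemma fcupE a b u c : u ⊑ a ⊔ b ->
  (forall v, v ⊑ u -> v ⊑ a -> v ⊑ c) -> (forall v, v ⊑ u -> v ⊑ b -> v ⊑ c) ->
  u ⊑ c.
Proof.
move=> h ka kb; apply: (fle_trans _ (fle_meet (fle_refl u) h)).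
apply: (fle_trans _ (fmeet_sup _ _)); apply: fsup_lub => _ [_ [->|->] ->].
  by apply: ka => //; [apply: fmeet_lel|apply: fmeet_ler].
by apply: kb => //; [apply: fmeet_lel|apply: fmeet_ler].
Qed.

Lemma fmeetP a b u : u ⊑ a ⊓ b -> u ⊑ a /\ u ⊑ b.
Proof.
by move=> h; split; apply: (fle_trans _ h);
  [apply: fmeet_lel|apply: fmeet_ler].
Qed.

Lemma fle_lub a b c : a ⊑ c -> b ⊑ c -> a ⊔ b ⊑ c.
Proof. by move=> ha hb; apply: fsup_lub => _ [->|->]. Qed.

Lemma feq_forces a b : (forall u, u ⊑ a <-> u ⊑ b) -> a = b.
Proof.
by move=> h; apply: fle_anti; [apply/h|apply/(h b)]; apply: fle_refl.
Qed.

End FrameTheory.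

(* [down vu], for [vu : v ⊑ u], transports all facts from stage u to stage v. *)
Ltac down vu :=
  lazymatch type of vu with
  | fle ?v ?u =>
      repeat match goal with
      | H : fle u ?a |- _ => apply (fle_trans u vu) in H
      end; clear vu; try clear u
  end.

Record frame_hom (O O' : frame) := FrameHom {
  fhom :> O -> O';
  fhom_top : fhom ⊤ = ⊤;
  fhom_meet : forall a b, fhom (a ⊓ b) = fhom a ⊓ fhom b;
  fhom_sup : forall S : O -> Prop,
    fhom (fsup S) = fsup (fun b => exists2 a, S a & b = fhom a)
}.

Section FrameHomTheory.
Variables (O O' : frame) (f : frame_hom O O').

Lemma fhom_join I (P : I -> Prop) (A : I -> O) :
  f (fjoin P A) = fjoin P (fun i => f (A i)).
Proof.
rewrite fhom_sup; apply: fle_anti; apply: fsup_lub.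
  by move=> _ [_ [i Pi ->] ->]; apply: fsup_ub; exists i.
by move=> _ [i Pi ->]; apply: fsup_ub; exists (A i) => //; exists i.
Qed.

Lemma fhom_cup a b : f (a ⊔ b) = f a ⊔ f b.
Proof.
rewrite fhom_sup; apply: fle_anti; apply: fsup_lub.
  by move=> _ [_ [->|->] ->]; apply: fsup_ub; [left|right].
by move=> _ [->|->]; apply: fsup_ub; [exists a|exists b] => //; [left|right].
Qed.

Lemma fhom_bot : f ⊥ = ⊥.
Proof.
rewrite fhom_sup; apply: fle_anti; apply: fsup_lub => //.
by move=> b [a []].
Qed.

Lemma fhom_le a b : a ⊑ b -> f a ⊑ f b.
Proof.
move=> ab; have -> : a = a ⊓ b.
  by apply: fle_anti; [apply: fle_meet => //; apply: fle_refl|apply: fmeet_lel].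
by rewrite fhom_meet; apply: fmeet_ler.
Qed.

End FrameHomTheory.


(* A generalised point of the space of Dedekind reals at the stage (space)
   with frame of opens O: the subsets L, R of the rationals are O-valued and
   the axioms of Dedekind cuts are imposed in O. *)
Record real (O : frame) := Real {
  lower : rat -> O;
  upper : rat -> O;
  lower_inh : ⊤ ⊑ ⋁_(q | True) lower q;
  upper_inh : ⊤ ⊑ ⋁_(r | True) upper r;
  lower_rounded : forall q, lower q = ⋁_(q' | q < q') lower q';
  upper_rounded : forall r, upper r = ⋁_(r' | r' < r) upper r';
  cut_disjoint : forall q r, r <= q -> lower q ⊓ upper r ⊑ ⊥;
  cut_located : forall q r, q < r -> ⊤ ⊑ lower q ⊔ upper r
}.

(* generalised points of the open subspace 0 < x *)
Record pos (O : frame) := Pos {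
  pval :> real O;
  pos_gt0 : ⊤ ⊑ lower pval 0
}.


Section RealTheory.
Variable O : frame.
Implicit Types (u v c : O) (x y z : real O).

(* Equality of generalised points is Leibniz equality. *)
Lemma real_ext x y :
  (forall q, lower x q = lower y q) -> (forall r, upper x r = upper y r) ->
  x = y.
Proof.
case: x y => [L R p1 p2 p3 p4 p5 p6] [L' R' q1 q2 q3 q4 q5 q6] /= eL eR.
have eL' : L = L' by apply: functional_extensionality.
have eR' : R = R' by apply: functional_extensionality.
by subst L' R'; f_equal; apply: proof_irrelevance.
Qed.

Lemma lower_open x q u c : u ⊑ lower x q ->
  (forall q' v, v ⊑ u -> q < q' -> v ⊑ lower x q' -> v ⊑ c) -> u ⊑ c.
Proof. by rewrite lower_rounded => h k; apply: (fjoinE h) => i v vu; apply: k. Qed.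

Lemma upper_open x r u c : u ⊑ upper x r ->
  (forall r' v, v ⊑ u -> r' < r -> v ⊑ upper x r' -> v ⊑ c) -> u ⊑ c.
Proof. by rewrite upper_rounded => h k; apply: (fjoinE h) => i v vu; apply: k. Qed.

Lemma lower_down x q q' u : q' <= q -> u ⊑ lower x q -> u ⊑ lower x q'.
Proof.
rewrite le_eqVlt => /orP[/eqP-> //|qq] h.
by rewrite lower_rounded; apply: (fjoinI (i := q)).
Qed.

Lemma upper_up x r r' u : r <= r' -> u ⊑ upper x r -> u ⊑ upper x r'.
Proof.
rewrite le_eqVlt => /orP[/eqP<- //|qq] h.
by rewrite upper_rounded; apply: (fjoinI (i := r)).
Qed.

Lemma cut_lt x q r u c : u ⊑ lower x q -> u ⊑ upper x r ->
  (q < r -> u ⊑ c) -> u ⊑ c.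
Proof.
move=> hq hr k; case: (ltP q r) => // rq.
apply: fbotE; apply: (fle_trans _ _ (cut_disjoint x rq)).
exact: fle_meet.
Qed.

Lemma locate x q r u c : q < r ->
  (forall v, v ⊑ u -> v ⊑ lower x q -> v ⊑ c) ->
  (forall v, v ⊑ u -> v ⊑ upper x r -> v ⊑ c) -> u ⊑ c.
Proof.
move=> qr; apply: fcupE.
by apply: (fle_trans _ (fle_top _)); apply: cut_located.
Qed.

Lemma lower_bound x u c :
  (forall q v, v ⊑ u -> v ⊑ lower x q -> v ⊑ c) -> u ⊑ c.
Proof.
move=> k; apply: (fjoinE (fle_trans _ (fle_top u) (lower_inh x))) => q v vu _.
exact: k.
Qed.

Lemma upper_bound x u c :
  (forall r v, v ⊑ u -> v ⊑ upper x r -> v ⊑ c) -> u ⊑ c.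
Proof.
move=> k; apply: (fjoinE (fle_trans _ (fle_top u) (upper_inh x))) => q v vu _.
exact: k.
Qed.

Lemma real_eqL x y :
  (forall q u, u ⊑ lower x q -> u ⊑ lower y q) ->
  (forall q u, u ⊑ lower y q -> u ⊑ lower x q) -> x = y.
Proof.
have aux a b : (forall q u, u ⊑ lower a q -> u ⊑ lower b q) ->
    forall r u, u ⊑ upper b r -> u ⊑ upper a r.
  move=> h r u hu; apply: (upper_open hu) => r' v vu rr hr; down vu.
  apply: (@locate a r' r v) => // w wv hw; down wv => //.
  by apply: (cut_lt (h _ _ hw) hr); rewrite ltxx.
move=> xy yx; apply: real_ext => q; apply: feq_forces => u; split; auto.
  exact: aux.
exact: aux.
Qed.

(* arbitrarily precise rational approximations *)
Lemma approx x e u c : 0 < e ->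
  (forall a b v, v ⊑ u -> v ⊑ lower x a -> v ⊑ upper x b -> b - a < e -> v ⊑ c) ->
  u ⊑ c.
Proof.
move=> e0 k.
have main (n : nat) : forall a b u, b - a <= e / 3%:R * n%:R ->
    u ⊑ lower x a -> u ⊑ upper x b ->
    (forall a b v, v ⊑ u -> v ⊑ lower x a -> v ⊑ upper x b -> b - a < e -> v ⊑ c) ->
    u ⊑ c.
  elim: n => [|n IHn] a b {k}{}u ab ha hb k.
    by apply: (cut_lt ha hb) => ?; lra.
  apply: (@locate x (a + e / 3%:R) (a + 2%:R * (e / 3%:R)) u); first by lra.
    move=> v vu hv; have vu' := vu; down vu'.
    apply: (IHn (a + e / 3%:R) b) => //.
      by move: ab; rewrite -natr1; nra.
    move=> a' b' w wv; apply: k; exact: (fle_trans _ wv).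
  move=> v vu hv; apply: (k a _ v vu (fle_trans _ vu ha) hv).
  by move: e0; clear; lra.
apply: (@lower_bound x) => a v vu ha; apply: (@upper_bound x) => b w wv hb.
have wu := fle_trans _ wv vu; down wv.
have [n hn] : exists n : nat, b - a <= e / 3%:R * n%:R.
  have e3 : 0 < e / 3%:R by lra.
  exists (Num.bound `|(b - a) / (e / 3%:R)|).
  rewrite mulrC -ler_pdivrMr //; apply: le_trans (ler_norm _) _.
  by apply: ltW; apply: archi_boundP; apply: normr_ge0.
apply: (main n a b w hn ha hb) => a' b' t tw; apply: k; exact: (fle_trans _ tw).
Qed.

End RealTheory.

Section RationalBounds.
Implicit Types (a b q r s t : rat) (n k : nat).

Lemma exists_mid q r : q < r -> exists2 s, q < s & s < r.
Proof. by move=> qr; exists ((q + r) / 2%:R); lra. Qed.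

Lemma exists_mid_pos q r : q < r -> 0 < r -> exists s, [/\ 0 < s, q < s & s < r].
Proof.
move=> qr r0; case: (ltP 0 q) => q0.
  by have [s qs sr] := exists_mid qr; exists s; split=> //; apply: lt_trans qs.
by exists (r / 2%:R); split; lra.
Qed.

Lemma root_gt1_lt n s : 1 < s -> exists2 t, 1 < t & t ^+ n < s.
Proof.
elim: n s => [|n IHn] s s1; first by exists 2%:R; rewrite ?expr0.
have [d [d0 d1 ds]] : exists d : rat, [/\ 0 < d, d < 1 & 3%:R * d < s - 1].
  pose m := Num.min 1 ((s - 1) / 3%:R).
  have m0 : 0 < m by rewrite lt_min; apply/andP; split; lra.
  have m1 : m <= 1 by rewrite ge_min lexx.
  have ms : m <= (s - 1) / 3%:R by rewrite ge_min lexx orbT.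
  by exists (m / 2%:R); split; lra.
have h1 : 1 < 1 + d by lra.
have [t t1 ts] := IHn _ h1.
have t'1 : 1 < Num.min t (1 + d) by rewrite lt_min t1 h1.
exists (Num.min t (1 + d)) => //.
set m := Num.min t (1 + d) in t'1 *.
have mt : m <= t by rewrite ge_min lexx.
have md : m <= 1 + d by rewrite ge_min lexx orbT.
have m0 : 0 <= m by lra.
have mn : m ^+ n < 1 + d.
  by apply: le_lt_trans ts; rewrite lerXn2r ?nnegrE //; lra.
have mn0 : 0 <= m ^+ n by rewrite exprn_ge0.
rewrite exprS; nra.
Qed.

Lemma bernoulli n t : 0 <= t -> 1 + n%:R * t <= (1 + t) ^+ n.
Proof.
move=> t0; elim: n => [|n IHn]; first by rewrite mul0r addr0 expr0.
rewrite exprS -natr1.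
have n0 : 0 <= n%:R :> rat by [].
by move: n0 IHn; set N := n%:R; set X := _ ^+ n; nra.
Qed.

Lemma archi_mul s t : 0 < t -> exists n, s < n%:R * t.
Proof.
move=> t0; exists (Num.bound `|s / t|); rewrite -ltr_pdivrMr //.
by apply: le_lt_trans (ler_norm _) _; apply: archi_boundP.
Qed.

Lemma expr_unbounded s t : 1 < t -> exists n, s < t ^+ n.
Proof.
move=> t1; have t0 : 0 < t - 1 by lra.
have [n hn] := archi_mul s t0; exists n.
have e : 1 + (t - 1) = t by ring.
have := bernoulli n (ltW t0); rewrite e.
by move: hn; set N := n%:R * _; lra.
Qed.

Lemma pow_dense (b : nat) q r : (0 < b)%N -> q < r -> 0 < r ->
  exists s, [/\ 0 < s, q < s ^+ b & s ^+ b < r].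
Proof.
move=> b0 qr r0.
have small t : 0 < t -> exists s, [/\ 0 < s, s ^+ b < t & s <= 1].
  move=> t0; exists (Num.min 1 (t / 2%:R)).
  set m := Num.min _ _.
  have m0 : 0 < m by rewrite lt_min; apply/andP; split; lra.
  have m1 : m <= 1 by rewrite ge_min lexx.
  have mt : m <= t / 2%:R by rewrite ge_min lexx orbT.
  split=> //; apply: (@le_lt_trans _ _ m); last lra.
  case: b b0 => // b _; rewrite exprS -[leRHS]mulr1.
  by rewrite ler_wpM2l ?exprn_ile1 // ltW.
case: (ltP 0 q) => q0; last first.
  by have [s [s0 st _]] := small _ r0; exists s; split=> //; apply: le_lt_trans q0 _; rewrite exprn_gt0.
have rq : 1 < r / q by rewrite ltr_pdivlMr // mul1r.
have [t t1 tb] := root_gt1_lt b rq.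
have [a [a0 ar a1]] := small _ r0.
have tn0 k : 0 < t ^+ k by rewrite exprn_gt0 // (lt_trans _ t1).
have ex : exists n, q < (a * t ^+ n) ^+ b.
  have [n hn] := expr_unbounded (Num.max 1 q / a) t1; exists n.
  move: hn; rewrite ltr_pdivrMr // gt_max mulrC => /andP[h1 hq].
  apply: lt_le_trans hq _; case: b b0 {small tb ar} => // b _.
  by rewrite exprS ler_peMr ?exprn_ege1 ?(ltW h1) // ltW // mulr_gt0.
case: (ex_minnP ex) => -[|n] hn hmin.
  by exists a; split=> //; move: hn; rewrite expr0 mulr1.
exists (a * t ^+ n.+1); split=> //; first by rewrite mulr_gt0.
have le_q : (a * t ^+ n) ^+ b <= q.
  by rewrite leNgt; apply/negP => /hmin; rewrite ltnn.
rewrite exprS mulrCA mulrC exprMn.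
apply: (@le_lt_trans _ _ (q * t ^+ b)); first by rewrite ler_wpM2r // ltW.
by move: tb; rewrite ltr_pdivlMr // mulrC.
Qed.

End RationalBounds.

Section PositiveReals.
Variable O : frame.
Implicit Types (u v c : O) (x y z : pos O).

Lemma pos_eq x y : pval x = pval y -> x = y.
Proof.
by case: x y => [x hx] [y hy] /= e; subst y; f_equal; apply: proof_irrelevance.
Qed.

Lemma pos_eqL x y :
  (forall q u, u ⊑ lower x q -> u ⊑ lower y q) ->
  (forall q u, u ⊑ lower y q -> u ⊑ lower x q) -> x = y.
Proof. by move=> h1 h2; apply/pos_eq/real_eqL. Qed.

Lemma forces_pos x u : u ⊑ lower x 0.
Proof. exact: fle_trans _ (fle_top u) (pos_gt0 x). Qed.

Lemma upper_pos x r u c : u ⊑ upper x r -> (0 < r -> u ⊑ c) -> u ⊑ c.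
Proof. exact: cut_lt (forces_pos x u). Qed.

Lemma lower_pos x q u c : u ⊑ lower x q ->
  (forall q' v, v ⊑ u -> 0 < q' -> q < q' -> v ⊑ lower x q' -> v ⊑ c) -> u ⊑ c.
Proof.
move=> hq k.
have hm : u ⊑ lower x (Num.max q 0).
  by case: (leP q 0) => // _; apply: forces_pos.
by apply: (lower_open hm) => q' v vu; rewrite gt_max => /andP[h1 h2]; apply: k.
Qed.

(* approximation within a prescribed ratio *)
Lemma approx_ratio x t u c : 1 < t ->
  (forall a b v, v ⊑ u -> 0 < a -> v ⊑ lower x a -> v ⊑ upper x b ->
     b <= t * a -> v ⊑ c) -> u ⊑ c.
Proof.
move=> t1 k; apply: (lower_pos (forces_pos x u)) => a0 v vu _ a0p ha0.
have e0 : 0 < (t - 1) * a0 by rewrite mulr_gt0 // subr_gt0.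
apply: (approx (x := x) e0) => a b w wv ha hb ab.
apply: (k (Num.max a a0) b) => //.
- exact: fle_trans _ wv vu.
- by rewrite lt_max a0p orbT.
- by case: (leP a a0) => // _; apply: fle_trans _ wv ha0.
- have h1 : a <= Num.max a a0 by rewrite le_max lexx.
  have h2 : a0 <= Num.max a a0 by rewrite le_max lexx orbT.
  by move: h1 h2 ab; set m := Num.max _ _; nra.
Qed.

End PositiveReals.

(* A real given by O-valued cuts satisfying the axioms in forcing form. *)
Section MakeReal.
Variables (O : frame) (L R : rat -> O).
Hypothesis L_inh : forall u c : O,
  (forall q v, v ⊑ u -> v ⊑ L q -> v ⊑ c) -> u ⊑ c.
Hypothesis R_inh : forall u c : O,
  (forall q v, v ⊑ u -> v ⊑ R q -> v ⊑ c) -> u ⊑ c.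
Hypothesis L_down : forall (q q' : rat) u, q < q' -> u ⊑ L q' -> u ⊑ L q.
Hypothesis R_up : forall (r r' : rat) u, r' < r -> u ⊑ R r' -> u ⊑ R r.
Hypothesis L_open : forall q u c, u ⊑ L q ->
  (forall q' v, v ⊑ u -> q < q' -> v ⊑ L q' -> v ⊑ c) -> u ⊑ c.
Hypothesis R_open : forall r u c, u ⊑ R r ->
  (forall r' v, v ⊑ u -> r' < r -> v ⊑ R r' -> v ⊑ c) -> u ⊑ c.
Hypothesis LR_disj : forall (q r : rat) u, r <= q -> u ⊑ L q -> u ⊑ R r -> u ⊑ ⊥.
Hypothesis LR_loc : forall (q r : rat) u c, q < r ->
  (forall v, v ⊑ u -> v ⊑ L q -> v ⊑ c) ->
  (forall v, v ⊑ u -> v ⊑ R r -> v ⊑ c) -> u ⊑ c.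

Definition mk_real : real O.
Proof.
apply: (@Real O L R).
- by apply: L_inh => q v _ h; apply: (fjoinI (i := q)).
- by apply: R_inh => q v _ h; apply: (fjoinI (i := q)).
- move=> q; apply: fle_anti.
    by apply: (L_open (fle_refl _)) => q' v _ qq h; apply: (fjoinI (i := q')).
  by apply: (fjoinE (fle_refl _)) => q' v _ qq h; apply: (L_down qq).
- move=> r; apply: fle_anti.
    by apply: (R_open (fle_refl _)) => q' v _ qq h; apply: (fjoinI (i := q')).
  by apply: (fjoinE (fle_refl _)) => q' v _ qq h; apply: (R_up qq).
- move=> q r rq; have [h1 h2] := fmeetP (fle_refl (L q ⊓ R r)).
  exact: LR_disj rq h1 h2.
- move=> q r qr; apply: (LR_loc qr) => v _ h; [exact: fcupl|exact: fcupr].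
Defined.
End MakeReal.

(* the truth value in O of an external proposition *)
Definition fprop {O : frame} (P : Prop) : O := fsup (fun c => P /\ c = ⊤).

Lemma fpropI (O : frame) (P : Prop) (u : O) : P -> u ⊑ fprop P.
Proof. by move=> p; apply: (fle_trans _ (fle_top u)); apply: fsup_ub. Qed.

Lemma fpropE (O : frame) (P : Prop) (u c : O) :
  u ⊑ fprop P -> (P -> u ⊑ c) -> u ⊑ c.
Proof.
move=> h k; apply: (fle_trans _ (fle_meet (fle_refl u) h)).
apply: (fle_trans _ (fmeet_sup _ _)); apply: fsup_lub => _ [_ [p ->] ->].
by apply: (fle_trans _ (fmeet_lel _ _)); apply: k.
Qed.

Lemma fhom_prop (O O' : frame) (f : frame_hom O O') P : f (fprop P) = fprop P.
Proof.
rewrite fhom_sup; apply: fle_anti; apply: fsup_lub.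
  by move=> _ [_ [p ->] ->]; rewrite fhom_top; apply: fpropI.
by move=> _ [p ->]; apply: fsup_ub; exists ⊤; rewrite ?fhom_top.
Qed.

Section Arithmetic.
Variable O : frame.
Implicit Types (u v c : O).

(* 1 as a Dedekind real: q < 1 and 1 < r in the rationals *)
Definition rone : real O.
Proof.
apply: (@mk_real O (fun q => fprop (q < 1)) (fun r => fprop (1 < r))).
- by move=> u c k; apply: (k 0) (fle_refl _) _; apply: fpropI.
- by move=> u c k; apply: (k 2%:R) (fle_refl _) _; apply: fpropI.
- move=> q q' u qq h; apply: (fpropE h) => h'.
  by apply: fpropI; apply: lt_trans h'.
- move=> r r' u qq h; apply: (fpropE h) => h'.
  by apply: fpropI; apply: lt_trans h' qq.
- move=> q u c h k; apply: (fpropE h) => h'.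
  have [s h1 h2] := exists_mid h'.
  by apply: (k s) => //; [apply: fle_refl|apply: fpropI].
- move=> q u c h k; apply: (fpropE h) => h'.
  have [s h1 h2] := exists_mid h'.
  by apply: (k s) => //; [apply: fle_refl|apply: fpropI].
- move=> q r u rq h1 h2; apply: (fpropE h1) => h1'; apply: (fpropE h2) => h2'.
  by have := lt_trans (lt_le_trans h2' rq) h1'; rewrite ltxx.
- move=> q r u c qr k1 k2; case: (ltP q 1) => h.
    by apply: k1; [apply: fle_refl|apply: fpropI].
  by apply: k2; [apply: fle_refl|apply: fpropI; apply: le_lt_trans h qr].
Defined.

Definition one : pos O.
Proof. by exists rone; apply: fpropI. Defined.

Definition ropp (z : real O) : real O.
Proof.
apply: (@mk_real O (fun q => upper z (- q)) (fun r => lower z (- r))).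
- move=> u c k; apply: (@upper_bound _ z) => r v vu h.
  by apply: (k (- r)) vu _; rewrite opprK.
- move=> u c k; apply: (@lower_bound _ z) => r v vu h.
  by apply: (k (- r)) vu _; rewrite opprK.
- by move=> q q' u qq; apply: upper_up; rewrite lerN2 ltW.
- by move=> r r' u qq; apply: lower_down; rewrite lerN2 ltW.
- move=> q u c h k; apply: (upper_open h) => r v vu rq hr.
  by apply: (k (- r)) vu _ _; rewrite ?opprK // ltrNr.
- move=> q u c h k; apply: (lower_open h) => r v vu rq hr.
  by apply: (k (- r)) vu _ _; rewrite ?opprK // ltrNl.
- move=> q r u rq h1 h2; apply: (cut_lt h2 h1).
  by rewrite ltrN2 ltNge rq.
- move=> q r u c qr k1 k2; apply: (@locate _ z (- r) (- q)) => //.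
  by rewrite ltrN2.
Defined.

(* Product of positive reals: q < xy iff there are positive rationals a < x and
   b < y with q < ab, and dually; the formula is wrong for other reals. *)
Definition lower_mul (x y : real O) (q : rat) : O :=
  ⋁_((a, b) | [/\ 0 < a, 0 < b & q < a * b]) (lower x a ⊓ lower y b).
Definition upper_mul (x y : real O) (r : rat) : O :=
  ⋁_((a, b) | [/\ 0 < a, 0 < b & a * b < r]) (upper x a ⊓ upper y b).

Lemma lower_mulI (x y : real O) q a b u : 0 < a -> 0 < b -> q < a * b ->
  u ⊑ lower x a -> u ⊑ lower y b -> u ⊑ lower_mul x y q.
Proof.
by move=> a0 b0 qab ha hb; apply: (fjoinI (i := (a, b))) => //; apply: fle_meet.
Qed.

Lemma upper_mulI (x y : real O) r a b u : 0 < a -> 0 < b -> a * b < r ->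
  u ⊑ upper x a -> u ⊑ upper y b -> u ⊑ upper_mul x y r.
Proof.
by move=> a0 b0 qab ha hb; apply: (fjoinI (i := (a, b))) => //; apply: fle_meet.
Qed.

Lemma lower_mulE (x y : real O) q u c : u ⊑ lower_mul x y q ->
  (forall a b v, v ⊑ u -> 0 < a -> 0 < b -> q < a * b ->
     v ⊑ lower x a -> v ⊑ lower y b -> v ⊑ c) -> u ⊑ c.
Proof.
move=> h k; apply: (fjoinE h) => -[a b] v vu [a0 b0 ab] hv.
by have [ha hb] := fmeetP hv; apply: (k a b).
Qed.

Lemma upper_mulE (x y : real O) r u c : u ⊑ upper_mul x y r ->
  (forall a b v, v ⊑ u -> 0 < a -> 0 < b -> a * b < r ->
     v ⊑ upper x a -> v ⊑ upper y b -> v ⊑ c) -> u ⊑ c.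
Proof.
move=> h k; apply: (fjoinE h) => -[a b] v vu [a0 b0 ab] hv.
by have [ha hb] := fmeetP hv; apply: (k a b).
Qed.

Lemma lower_mul_neg (x y : pos O) q u : q <= 0 -> u ⊑ lower_mul x y q.
Proof.
move=> q0; apply: (lower_pos (forces_pos x u)) => a v vu a0 _ ha.
apply: (fle_trans _ (fle_refl v)); apply: (lower_pos (forces_pos y v)) => b w wv b0 _ hb.
apply: (lower_mulI a0 b0 _ (fle_trans _ wv ha) hb).
by apply: le_lt_trans q0 _; apply: mulr_gt0.
Qed.

Definition rmul (x y : pos O) : real O.
Proof.
apply: (@mk_real O (lower_mul x y) (upper_mul x y)).
- by move=> u c k; apply: (k 0) (fle_refl _) _; apply: lower_mul_neg.
- move=> u c k; apply: (@upper_bound _ x) => r v vu hr.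
  apply: (upper_pos hr) => r0; apply: (@upper_bound _ y) => s w wv hs.
  apply: (upper_pos hs) => s0.
  apply: (k (r * s + 1)) (fle_trans _ wv vu) _.
  by apply: (upper_mulI r0 s0 _ (fle_trans _ wv hr) hs); lra.
- move=> q q' u qq h; apply: (lower_mulE h) => a b v vu a0 b0 ab.
  by apply: (lower_mulI a0 b0); apply: lt_trans ab.
- move=> q q' u qq h; apply: (upper_mulE h) => a b v vu a0 b0 ab.
  by apply: (upper_mulI a0 b0); apply: lt_trans qq.
- move=> q u c h k; apply: (lower_mulE h) => a b v vu a0 b0 ab ha hb.
  have [s h1 h2] := exists_mid ab.
  by apply: (k s) => //; apply: lower_mulI ha hb.
- move=> q u c h k; apply: (upper_mulE h) => a b v vu a0 b0 ab ha hb.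
  have [s h1 h2] := exists_mid ab.
  by apply: (k s) => //; apply: upper_mulI ha hb.
- move=> q r u rq h1 h2.
  apply: (lower_mulE h1) => a b v vu a0 b0 qab ha hb; down vu.
  apply: (upper_mulE h2) => a' b' w wv a'0 b'0 abr ha' hb'; down wv.
  apply: (cut_lt ha ha') => aa; apply: (cut_lt hb hb') => bb.
  by have : a * b < a' * b'; [apply: ltr_pM => //; exact: ltW|lra].
- move=> q r u c qr k1 k2; case: (leP q 0) => q0.
    by apply: (k1 _ (fle_refl u)); apply: lower_mul_neg.
  have rq : 1 < r / q by rewrite ltr_pdivlMr // mul1r.
  have [t t1 tr] := root_gt1_lt 2 rq.
  apply: (approx_ratio (x := x) t1) => a b v vu a0 ha hb hab.
  apply: (approx_ratio (x := y) t1) => a' b' w wv a'0 ha' hb' hab'.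
  have wu := fle_trans _ wv vu; down wv.
  apply: (cut_lt ha hb) => ab; apply: (cut_lt ha' hb') => ab'.
  case: (ltP q (a * a')) => h.
    by apply: (k1 _ wu); apply: lower_mulI ha ha'.
  have b0 := lt_trans a0 ab; have b'0 := lt_trans a'0 ab'.
  apply: (k2 _ wu); apply: (upper_mulI b0 b'0 _ hb hb').
  have h1 : b * b' <= (t * a) * (t * a') by apply: ler_pM => //; apply: ltW.
  apply: le_lt_trans h1 _; rewrite mulrACA -expr2.
  apply: (@le_lt_trans _ _ (t ^+ 2 * q)).
    by rewrite ler_wpM2l // exprn_ge0 //; lra.
  by move: tr; rewrite ltr_pdivlMr.
Defined.

Definition mul (x y : pos O) : pos O.
Proof. by exists (rmul x y); apply: lower_mul_neg. Defined.

(* q < 1/x iff qr < 1 for some positive rational r > x, for x positive *)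
Definition lower_inv (x : real O) (q : rat) : O :=
  ⋁_(r | 0 < r /\ q * r < 1) upper x r.
Definition upper_inv (x : real O) (r : rat) : O :=
  ⋁_(q | 0 < q /\ 1 < q * r) lower x q.

Lemma lower_inv_neg (x : real O) q u : q <= 0 -> u ⊑ lower_inv x q.
Proof.
move=> q0; apply: (@upper_bound _ x) => r v vu hr.
apply: (fjoinI (i := Num.max 1 r)).
  split; first by rewrite lt_max ltr01.
  by apply: le_lt_trans ltr01; rewrite mulr_le0_ge0 // le_max ler01.
by apply: upper_up hr; rewrite le_max lexx orbT.
Qed.

Definition rinv (x : pos O) : real O.
Proof.
apply: (@mk_real O (lower_inv x) (upper_inv x)).
- by move=> u c k; apply: (k 0) (fle_refl _) _; apply: lower_inv_neg.
- move=> u c k; apply: (lower_pos (forces_pos x u)) => a v vu a0 _ ha.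
  apply: (k (2%:R / a)) vu _; apply: (fjoinI (i := a)) => //; split=> //.
  by rewrite mulrC divfK ?gt_eqF.
- move=> q q' u qq h; apply: (fjoinE h) => r v vu [r0 hr] h'.
  apply: (fjoinI (i := r)) => //; split=> //; apply: lt_trans hr.
  by rewrite ltr_pM2r.
- move=> q q' u qq h; apply: (fjoinE h) => r v vu [r0 hr] h'.
  apply: (fjoinI (i := r)) => //; split=> //; apply: (lt_trans hr).
  by rewrite ltr_pM2l.
- move=> q u c h k; apply: (fjoinE h) => r v vu [r0 hr] h'.
  have [s h1 h2] : exists2 s, q < s & s < 1 / r.
    by apply: exists_mid; rewrite ltr_pdivlMr.
  apply: (k s) vu h1 _; apply: (fjoinI (i := r)) => //; split=> //.
  by rewrite -ltr_pdivlMr.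
- move=> q u c h k; apply: (fjoinE h) => r v vu [r0 hr] h'.
  have [s h1 h2] : exists2 s, 1 / r < s & s < q.
    by apply: exists_mid; rewrite ltr_pdivrMr // mulrC.
  apply: (k s) vu h2 _; apply: (fjoinI (i := r)) => //; split=> //.
  by move: h1; rewrite ltr_pdivrMr // mulrC.
- move=> q r u rq h1 h2.
  apply: (fjoinE h1) => b v vu [b0 qb] hb; down vu.
  apply: (fjoinE h2) => a w wv [a0 ra] ha; down wv.
  apply: (cut_lt ha hb) => ab.
  case: (leP r 0) => r0; first by have := mulr_ge0_le0 (ltW a0) r0; lra.
  have h3 : q * b < a * r by lra.
  have h4 : r * a <= q * b by apply: ler_pM => //; apply: ltW.
  lra.
- move=> q r u c qr k1 k2; case: (leP q 0) => q0.
    by apply: (k1 _ (fle_refl u)); apply: lower_inv_neg.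
  have [s h1 h2] := exists_mid qr.
  have s0 : 0 < s by apply: lt_trans h1.
  have r0 : 0 < r by apply: lt_trans h2.
  apply: (@locate _ x s^-1 ((q + s) / 2%:R)^-1).
  - by rewrite ltf_pV2 ?posrE //; lra.
  - move=> v vu h; apply: (k2 _ vu); apply: (fjoinI (i := s^-1)) => //.
    by split; rewrite ?invr_gt0 // mulrC ltr_pdivlMr // mul1r.
  - move=> v vu h; apply: (k1 _ vu); apply: (fjoinI _ h); split.
      by rewrite invr_gt0; lra.
    by rewrite ltr_pdivrMr; lra.
Defined.

Definition inv (x : pos O) : pos O.
Proof. by exists (rinv x); apply: lower_inv_neg. Defined.

Definition npow (x : pos O) (n : nat) : pos O := iter n (mul x) one.

(* q < x^(1/b) iff q < a for some rational a >= 0 with a^b < x, and dually;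
   see root_pow and npow_inj for the characteristic property. *)
Definition lower_root (b : nat) (x : real O) (q : rat) : O :=
  ⋁_(a | 0 <= a /\ q < a) lower x (a ^+ b).
Definition upper_root (b : nat) (x : real O) (r : rat) : O :=
  ⋁_(a | 0 < a /\ a < r) upper x (a ^+ b).

Lemma lower_root_neg b (x : pos O) q u : (0 < b)%N -> q < 0 -> u ⊑ lower_root b x q.
Proof.
move=> b0 q0; apply: (fjoinI (i := 0)); first by split.
by rewrite expr0n gtn_eqF //; apply: forces_pos.
Qed.

Definition rroot (b : nat) (b0 : (0 < b)%N) (x : pos O) : real O.
Proof.
apply: (@mk_real O (lower_root b x) (upper_root b x)).
- move=> u c k; apply: (k (- 1)) (fle_refl _) _; apply: lower_root_neg => //.
- move=> u c k; apply: (@upper_bound _ x) => r v vu hr.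
  apply: (k (Num.max 1 r + 1)) vu _; apply: (fjoinI (i := Num.max 1 r)).
    by split; [rewrite lt_max ltr01|rewrite ltrDl].
  have h1 : 1 <= Num.max 1 r by rewrite le_max lexx.
  have h2 : r <= Num.max 1 r by rewrite le_max lexx orbT.
  apply: upper_up hr; apply: (le_trans h2).
  by apply: ler_eXnr.
- move=> q q' u qq h; apply: (fjoinE h) => a v vu [a0 ha] h'.
  by apply: (fjoinI (i := a)) => //; split=> //; apply: lt_trans ha.
- move=> q q' u qq h; apply: (fjoinE h) => a v vu [a0 ha] h'.
  by apply: (fjoinI (i := a)) => //; split=> //; apply: lt_trans ha _.
- move=> q u c h k; apply: (fjoinE h) => a v vu [a0 ha] h'.
  have [s h1 h2] := exists_mid ha.
  by apply: (k s) vu h1 _; apply: (fjoinI (i := a)).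
- move=> q u c h k; apply: (fjoinE h) => a v vu [a0 ha] h'.
  have [s h1 h2] := exists_mid ha.
  by apply: (k s) vu h2 _; apply: (fjoinI (i := a)).
- move=> q r u rq h1 h2.
  apply: (fjoinE h1) => a v vu [a0 qa] ha; down vu.
  apply: (fjoinE h2) => d w wv [d0 dr] hd; down wv.
  apply: (cut_lt ha hd); rewrite ltr_pXn2r ?nnegrE ?(ltW d0) // => ad.
  by move: qa dr rq ad; clear; lra.
- move=> q r u c qr k1 k2; case: (ltP q 0) => q0.
    by apply: (k1 _ (fle_refl u)); apply: lower_root_neg.
  have [s h1 h2] := exists_mid qr; have [t h3 h4] := exists_mid h2.
  have s0 : 0 <= s by apply: le_trans (ltW h1).
  have t0 : 0 < t by apply: le_lt_trans h3.
  apply: (@locate _ x (s ^+ b) (t ^+ b)).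
  - by rewrite ltr_pXn2r ?nnegrE ?(ltW t0).
  - by move=> v vu h; apply: (k1 _ vu); apply: (fjoinI (i := s)).
  - by move=> v vu h; apply: (k2 _ vu); apply: (fjoinI (i := t)).
Defined.

Definition nroot (b : nat) (b0 : (0 < b)%N) (x : pos O) : pos O.
Proof.
exists (rroot b0 x); apply: (lower_pos (forces_pos x _)) => a v vu a0 _ ha.
have [s [s0 _ sa]] := pow_dense b0 a0 a0.
apply: (fjoinI (i := s)); first by split=> //; exact: ltW.
by apply: lower_down ha; apply: ltW.
Defined.

End Arithmetic.
Arguments one {O}.

Section ArithmeticTheory.
Variable O : frame.
Implicit Types (u v c : O) (x y z : pos O).

Lemma mulC x y : mul x y = mul y x.
Proof.
by apply: pos_eqL => q u h; apply: (lower_mulE h) => a b v vu a0 b0 ab ha hb;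
  apply: (lower_mulI b0 a0 _ hb ha); rewrite mulrC.
Qed.

Lemma mulA x y z : mul x (mul y z) = mul (mul x y) z.
Proof.
apply: pos_eqL => q u h; apply: (lower_mulE h) => a b v vu a0 b0 qab ha hb.
  apply: (lower_mulE hb) => a' b' w wv a'0 b'0 bab ha' hb'; down wv.
  have [s [s0 h1 h2]] : exists s, [/\ 0 < s, q / b' < s & s < a * a'].
    apply: exists_mid_pos; last by apply: mulr_gt0.
    rewrite ltr_pdivrMr // -mulrA; apply: (lt_trans qab).
    by rewrite ltr_pM2l.
  apply: (lower_mulI s0 b'0 _ _ hb'); first by rewrite -ltr_pdivrMr.
  exact: lower_mulI ha ha'.
apply: (lower_mulE ha) => a' b' w wv a'0 b'0 bab ha' hb'; down wv.
have [s [s0 h1 h2]] : exists s, [/\ 0 < s, q / a' < s & s < b' * b].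
  apply: exists_mid_pos; last by apply: mulr_gt0.
  rewrite ltr_pdivrMr // mulrC mulrA; apply: (lt_trans qab).
  by rewrite ltr_pM2r.
apply: (lower_mulI a'0 s0 _ ha'); first by rewrite mulrC -ltr_pdivrMr.
exact: lower_mulI hb' hb.
Qed.

Lemma mul1 x : mul one x = x.
Proof.
apply: pos_eqL => q u h.
  apply: (lower_mulE h) => a b v vu a0 b0 qab ha hb.
  apply: (fpropE ha) => a1; apply: lower_down hb.
  by apply: ltW; apply: (lt_trans qab); rewrite gtr_pMl.
apply: (lower_pos h) => a v vu a0 qa ha.
have [s [s0 h1 h2]] : exists s, [/\ 0 < s, q / a < s & s < 1].
  by apply: exists_mid_pos => //; rewrite ltr_pdivrMr // mul1r.
apply: (lower_mulI s0 a0 _ _ ha); first by rewrite -ltr_pdivrMr.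
exact: fpropI.
Qed.

Lemma mulV x : mul x (inv x) = one.
Proof.
apply: pos_eqL => q u h.
  apply: (lower_mulE h) => a b v vu a0 b0 qab ha hb.
  apply: (fjoinE hb) => r w wv [r0 br] hr; down wv.
  apply: (cut_lt ha hr) => ar; apply: fpropI; apply: (lt_trans qab).
  by apply: lt_trans br; rewrite mulrC ltr_pM2l.
apply: (fpropE h) => q1; case: (leP q 0) => q0; first exact: lower_mul_neg.
have [s h1 h2] := exists_mid q1; have s0 : 0 < s by lra.
have t1 : 1 < s^-1 by rewrite invf_gt1.
have sq : 1 < s / q by rewrite ltr_pdivlMr // mul1r.
apply: (approx_ratio (x := x) t1) => a b v vu a0 ha hb bta.
apply: (cut_lt ha hb) => ab; have b0 := lt_trans a0 ab.
have [e h3 h4] : exists2 e, q / a < e & e < 1 / b.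
  apply: exists_mid; rewrite ltr_pdivrMr // mulrAC ltr_pdivlMr // mul1r.
  apply: (@le_lt_trans _ _ (q * (s^-1 * a))); first by rewrite ler_pM2l.
  by rewrite mulrA gtr_pMl // ltr_pdivrMr // mul1r.
have e0 : 0 < e by apply: lt_trans h3; rewrite divr_gt0.
apply: (lower_mulI a0 e0 _ ha); first by rewrite mulrC -ltr_pdivrMr.
by apply: (fjoinI (i := b)) => //; split; rewrite -?ltr_pdivlMr.
Qed.

Lemma mulI x y z : mul x y = mul x z -> y = z.
Proof.
move=> h; rewrite -(mul1 y) -(mul1 z) -(mulV x) (mulC x) -!mulA.
by rewrite h.
Qed.

Lemma mulAC x y z : mul (mul x y) z = mul (mul x z) y.
Proof. by rewrite -!mulA (mulC y). Qed.

Lemma mulACA x y z t : mul (mul x y) (mul z t) = mul (mul x z) (mul y t).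
Proof. by rewrite mulA (mulAC x) -mulA. Qed.

Lemma inv_one : inv one = one :> pos O.
Proof. by rewrite -[LHS]mul1 mulV. Qed.

Lemma npowS x n : npow x n.+1 = mul x (npow x n). Proof. by []. Qed.

Lemma npowD x n m : npow x (n + m) = mul (npow x n) (npow x m).
Proof. by elim: n => [|n IHn]; rewrite ?mul1 // addSn !npowS IHn mulA. Qed.

Lemma npowMl x y n : npow (mul x y) n = mul (npow x n) (npow y n).
Proof. by elim: n => [|n IHn]; rewrite ?mul1 // !npowS IHn mulACA. Qed.

Lemma npowM x n m : npow x (n * m) = npow (npow x n) m.
Proof. by elim: m => [|m IHm]; rewrite ?muln0 // mulnS npowD npowS IHm. Qed.

Lemma npow_one n : npow one n = one :> pos O.
Proof. by elim: n => // n IHn; rewrite npowS IHn mul1. Qed.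

Lemma lower_npowI x n a q u : 0 < a -> q < a ^+ n -> u ⊑ lower x a ->
  u ⊑ lower (npow x n) q.
Proof.
move=> a0; elim: n q => [|n IHn] q; first by rewrite expr0 => h _; apply: fpropI.
rewrite exprS => qa ha.
have an : 0 < a ^+ n by rewrite exprn_gt0.
have [s [s0 h1 h2]] : exists s, [/\ 0 < s, q / a < s & s < a ^+ n].
  by apply: exists_mid_pos => //; rewrite ltr_pdivrMr // mulrC.
apply: (lower_mulI a0 s0 _ ha); first by rewrite mulrC -ltr_pdivrMr.
exact: IHn.
Qed.

Lemma upper_npowI x n a q u : 0 < a -> a ^+ n < q -> u ⊑ upper x a ->
  u ⊑ upper (npow x n) q.
Proof.
move=> a0; elim: n q => [|n IHn] q; first by rewrite expr0 => h _; apply: fpropI.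
rewrite exprS => qa ha.
have an : 0 < a ^+ n by rewrite exprn_gt0.
have [s h1 h2] : exists2 s, a ^+ n < s & s < q / a.
  by apply: exists_mid; rewrite ltr_pdivlMr // mulrC.
apply: (upper_mulI a0 (lt_trans an h1) _ ha); last exact: IHn.
by rewrite mulrC -ltr_pdivlMr.
Qed.

Lemma lower_npowE x n q u c : u ⊑ lower (npow x n) q ->
  (forall a v, v ⊑ u -> 0 < a -> q < a ^+ n -> v ⊑ lower x a -> v ⊑ c) -> u ⊑ c.
Proof.
elim: n q u => [|n IHn] q u h k.
  apply: (fpropE h) => q1.
  apply: (lower_pos (forces_pos x u)) => a v vu a0 _ ha.
  by apply: (k a); rewrite ?expr0.
apply: (lower_mulE h) => a b v vu a0 b0 qab ha hb.
apply: (IHn _ _ hb) => a' w wv a'0 ba ha'.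
have wu := fle_trans _ wv vu; down wv.
set m := Num.max a a'.
have am : a <= m by rewrite le_max lexx.
have a'm : a' <= m by rewrite le_max lexx orbT.
have m0 := lt_le_trans a0 am.
apply: (k m w wu m0).
  apply: (lt_le_trans qab); rewrite exprS.
  apply: (ler_pM (ltW a0) (ltW b0) am); apply: (le_trans (ltW ba)).
  by apply: lerXn2r; rewrite ?nnegrE ?(ltW m0) ?(ltW a'0).
by rewrite /m; case: (leP a a').
Qed.

Lemma upper_npowE x n q u c : u ⊑ upper (npow x n) q ->
  (forall a v, v ⊑ u -> 0 < a -> a ^+ n < q -> v ⊑ upper x a -> v ⊑ c) -> u ⊑ c.
Proof.
elim: n q u => [|n IHn] q u h k.
  apply: (fpropE h) => q1; apply: (@upper_bound _ x) => a v vu ha.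
  by apply: (upper_pos ha) => a0; apply: (k a) => //; rewrite expr0.
apply: (upper_mulE h) => a b v vu a0 b0 qab ha hb.
apply: (IHn _ _ hb) => a' w wv a'0 ba ha'.
have wu := fle_trans _ wv vu; down wv.
set m := Num.min a a'.
have am : m <= a by rewrite ge_min lexx.
have a'm : m <= a' by rewrite ge_min lexx orbT.
have m0 : 0 < m by rewrite lt_min a0.
apply: (k m w wu m0).
  apply: le_lt_trans qab; rewrite exprS.
  apply: (ler_pM (ltW m0) (exprn_ge0 n (ltW m0)) am).
  by apply: (le_trans _ (ltW ba)); apply: lerXn2r; rewrite ?nnegrE ?(ltW m0) ?(ltW a'0).
by rewrite /m; case: (leP a a').
Qed.

Lemma root_pow b (b0 : (0 < b)%N) x : npow (nroot b0 x) b = x.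
Proof.
apply: pos_eqL => q u h.
  apply: (lower_npowE h) => a v vu a0 qa ha.
  apply: (fjoinE ha) => d w wv [d0 ad] hd; down wv.
  apply: lower_down hd; apply: ltW; apply: (lt_le_trans qa).
  by apply: lerXn2r; rewrite ?nnegrE // ltW.
apply: (lower_pos h) => a v vu a0 qa ha.
have [s [s0 h1 h2]] := pow_dense b0 qa a0.
have [t [t0 h3 h4]] := pow_dense b0 h2 a0.
apply: (lower_npowI s0 h1); apply: (fjoinI (i := t)).
  by split; [exact: ltW|rewrite -(ltr_pXn2r b0) ?nnegrE // ltW].
by apply: lower_down ha; apply: ltW.
Qed.

(* b-th roots are unique *)
Lemma npow_inj b x y : (0 < b)%N -> npow x b = npow y b -> x = y.
Proof.
move=> b0.
have aux s t : npow s b = npow t b -> forall q u, u ⊑ lower s q -> u ⊑ lower t q.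
  move=> e q u h; apply: (lower_pos h) => a v vu a0 qa ha.
  have [d [d0 h1 h2]] := exists_mid_pos qa a0.
  apply: (@locate _ t q d) => // w wv hw; down wv => //.
  have h3 : w ⊑ lower (npow s b) (d ^+ b).
    by apply: (lower_npowI a0 _ ha); rewrite ltr_pXn2r ?nnegrE ?ltW.
  apply: (upper_open hw) => d' w' w'w dd hd; down w'w.
  apply: (upper_pos hd) => d'0.
  have h4 : w' ⊑ upper (npow t b) (d ^+ b).
    by apply: (upper_npowI d'0 _ hd); rewrite ltr_pXn2r ?nnegrE ?ltW.
  by rewrite -e in h4; apply: (cut_lt h3 h4); rewrite ltxx.
by move=> e; apply: pos_eqL; apply: aux.
Qed.

End ArithmeticTheory.

Lemma absz_denq_gt0 q : (0 < `|denq q|)%N.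
Proof. by rewrite absz_gt0 denq_neq0. Qed.

Section RationalPowers.
Variable O : frame.
Implicit Types (u v c : O) (x y z : pos O).

(* x^q = (x^n)^(1/d) for q = n/d in lowest terms; by pow_nneg_spec and
   npow_inj any other fraction gives the same value. *)
Definition pow_nneg x (q : rat) : pos O :=
  nroot (absz_denq_gt0 q) (npow x `|numq q|).

Definition rat_pow x (q : rat) : pos O :=
  if 0 <= q then pow_nneg x q else inv (pow_nneg x (- q)).

Lemma nneg_ratE (q : rat) : 0 <= q -> q * `|denq q|%:R = `|numq q|%:R.
Proof.
move=> q0; rewrite -[X in X * _]divq_num_den !natr_absz.
rewrite (ger0_norm (_ : 0 <= numq q)) ?numq_ge0 // (gtr0_norm (denq_gt0 q)).
by rewrite divfK // intr_eq0 denq_neq0.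
Qed.

Lemma rat_repr (q : rat) :
  exists n m d : nat, (0 < d)%N /\ q * d%:R = n%:R - m%:R.
Proof.
case: (leP 0 q) => q0.
  by exists `|numq q|%N, 0%N, `|denq q|%N; rewrite absz_denq_gt0 nneg_ratE // subr0.
exists 0%N, `|numq (- q)|%N, `|denq (- q)|%N; rewrite absz_denq_gt0; split=> //.
by rewrite -nneg_ratE ?oppr_ge0 ?ltW // mulNr sub0r opprK.
Qed.

Lemma pow_nneg_spec x (q : rat) (n m d : nat) : 0 <= q ->
  q * d%:R = n%:R - m%:R ->
  mul (npow (pow_nneg x q) d) (npow x m) = npow x n.
Proof.
move=> q0 e; apply: (npow_inj (absz_denq_gt0 q)).
rewrite npowMl -!npowM mulnC npowM root_pow -npowM -npowD; congr npow.
have eN := nneg_ratE q0.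
apply/eqP; rewrite -(eqr_nat rat) natrD !natrM -eN.
by rewrite mulrAC e mulrBl subrK.
Qed.

(* x^((n - m) / d) is characterised by y^d x^m = x^n *)
Lemma rat_pow_spec x (q : rat) (n m d : nat) :
  q * d%:R = n%:R - m%:R ->
  mul (npow (rat_pow x q) d) (npow x m) = npow x n.
Proof.
rewrite /rat_pow; case: (leP 0 q) => [q0|q0] e; first exact: pow_nneg_spec.
have nq0 : 0 <= - q by rewrite oppr_ge0 ltW.
have e' : - q * d%:R = m%:R - n%:R by rewrite mulNr e opprB.
have <- := pow_nneg_spec x nq0 e'.
by rewrite mulA -npowMl (mulC (inv _)) mulV npow_one mul1.
Qed.

Lemma rat_pow_uniq x y (q : rat) (n m d : nat) : (0 < d)%N ->
  q * d%:R = n%:R - m%:R -> mul (npow y d) (npow x m) = npow x n ->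
  y = rat_pow x q.
Proof.
move=> d0 e h; apply: (npow_inj d0); apply: (@mulI _ (npow x m)).
by rewrite [LHS]mulC h [RHS]mulC (rat_pow_spec x e).
Qed.

Lemma rat_powD x (p q : rat) : rat_pow x (p + q) = mul (rat_pow x p) (rat_pow x q).
Proof.
have [n [m [d [d0 e]]]] := rat_repr p.
have [n' [m' [d' [d'0 e']]]] := rat_repr q.
apply/esym; apply: (@rat_pow_uniq _ _ _ (n * d' + n' * d) (m * d' + m' * d) (d * d')).
- by rewrite muln_gt0 d0.
- rewrite !natrD !natrM mulrDl mulrA e mulrCA e'; ring.
- rewrite npowMl (npowM (rat_pow x p)) (mulnC d d') (npowM (rat_pow x q)).
  rewrite !npowD !(npowM x) mulACA -!npowMl.
  by rewrite (rat_pow_spec x e) (rat_pow_spec x e').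
Qed.

Lemma rat_pow_one (q : rat) : rat_pow one q = one :> pos O.
Proof.
have [n [m [d [d0 e]]]] := rat_repr q.
by apply/esym/(rat_pow_uniq d0 e); rewrite !npow_one mul1.
Qed.

Lemma rat_pow_inv x q : rat_pow (inv x) q = inv (rat_pow x q).
Proof.
have [n [m [d [d0 e]]]] := rat_repr q.
apply/esym/(rat_pow_uniq d0 e).
have h := rat_pow_spec x e.
apply: (@mulI _ (npow x n)); rewrite -[RHS]npowMl mulV npow_one -{1}h.
by rewrite mulACA -!npowMl !mulV !npow_one mul1.
Qed.

(* x factors through the closed complement of the open (-oo, 1), respectively
   of (1, oo) *)
Definition ge1 x := upper x 1 ⊑ ⊥.
Definition le1 x := lower x 1 ⊑ ⊥.

Lemma le1_inv x : le1 x -> ge1 (inv x).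
Proof.
move=> h; apply: (fjoinE (fle_refl _)) => a v _ [a0 a1] ha.
by apply: (fle_trans _ _ h); apply: lower_down ha; rewrite mulr1 in a1; exact: ltW.
Qed.

Lemma ge1_one : ge1 one.
Proof. by apply: (fpropE (fle_refl _)); rewrite ltxx. Qed.

Lemma ge1_rat_pow x q : 0 <= q -> ge1 x -> ge1 (rat_pow x q).
Proof.
move=> q0 h; rewrite /rat_pow q0; set b := absz_denq_gt0 q.
suff hu u : u ⊑ upper (pow_nneg x q) 1 -> u ⊑ ⊥ by apply: hu; apply: fle_refl.
move=> hu.
apply: (upper_open hu) => r v vu r1 hr; down vu; apply: (upper_pos hr) => r0.
have h2 : v ⊑ upper (npow (pow_nneg x q) `|denq q|) 1.
  by apply: (upper_npowI r0 _ hr); rewrite exprn_ilt1 ?ltW // -lt0n absz_denq_gt0.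
rewrite root_pow in h2; apply: (upper_npowE h2) => a w wv a0 a1 ha; down wv.
apply: (fle_trans _ _ h); apply: upper_up ha.
by rewrite leNgt; apply/negP => ha1; have := exprn_ege1 `|numq q| (ltW ha1); lra.
Qed.

Lemma lower_mul_ge1 x y q u : ge1 y -> u ⊑ lower x q -> u ⊑ lower (mul x y) q.
Proof.
move=> y1 h; apply: (lower_pos h) => a v vu a0 qa ha.
have [s [s0 h1 h2]] : exists s, [/\ 0 < s, q / a < s & s < 1].
  by apply: exists_mid_pos => //; rewrite ltr_pdivrMr // mul1r.
apply: (@locate _ y s 1) => // w wv hw; down wv.
  by apply: (lower_mulI a0 s0 _ ha hw); rewrite mulrC -ltr_pdivrMr.
by apply: fbotE; apply: fle_trans _ hw y1.
Qed.

Lemma lower_rat_pow_mono x p q s u : ge1 x -> p <= q ->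
  u ⊑ lower (rat_pow x p) s -> u ⊑ lower (rat_pow x q) s.
Proof.
move=> x1 pq h; rewrite -[q](subrKC p) rat_powD; apply: lower_mul_ge1 h.
by apply: ge1_rat_pow => //; rewrite subr_ge0.
Qed.

Lemma upper_rat_pow_mono x p q s u : ge1 x -> p <= q ->
  u ⊑ upper (rat_pow x q) s -> u ⊑ upper (rat_pow x p) s.
Proof.
move=> x1 pq h; apply: (upper_open h) => r v vu rs hr.
apply: (@locate _ (rat_pow x p) r s) => // w wv hw; down wv.
by have h2 := lower_rat_pow_mono x1 pq hw; apply: (cut_lt h2 hr); rewrite ltxx.
Qed.

(* rational powers of bounded x with small exponents are close to 1 *)
Lemma small_rat_pow x M t u : 1 < t -> u ⊑ upper x M ->
  exists2 e : rat, 0 < e & u ⊑ upper (rat_pow x e) t.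
Proof.
move=> t1 hx; have [s s1 st] := exists_mid t1.
have [n hn] := expr_unbounded (Num.max 1 M) s1.
move: hn; rewrite gt_max => /andP[h1 hM].
have n0 : (0 < n)%N by case: n h1 {hM} => //; rewrite expr0 ltxx.
have n0' : (n%:R : rat) != 0 by rewrite pnatr_eq0 -lt0n.
exists n%:R^-1; first by rewrite invr_gt0 ltr0n.
have -> : rat_pow x n%:R^-1 = nroot n0 x.
  apply/esym; apply: (@rat_pow_uniq _ _ _ 1 0 n) => //.
    by rewrite mulVf // subr0.
  by rewrite root_pow /= !(mulC _ one) mul1.
apply: (fjoinI (i := s)); first by split=> //; lra.
by apply: upper_up hx; apply: ltW.
Qed.

End RationalPowers.

Section ExpGe1.
Variable O : frame.
Implicit Types (u v c : O) (x : pos O) (z : real O).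

(* q < x^z iff q < x^q' for some rational q' < z, and dually, for x >= 1 *)
Definition lower_exp x z (q : rat) : O :=
  ⋁_(q' | True) (lower z q' ⊓ lower (rat_pow x q') q).
Definition upper_exp x z (r : rat) : O :=
  ⋁_(q' | True) (upper z q' ⊓ upper (rat_pow x q') r).

Lemma lower_expI x z q q' u : u ⊑ lower z q' -> u ⊑ lower (rat_pow x q') q ->
  u ⊑ lower_exp x z q.
Proof. by move=> h1 h2; apply: (fjoinI (i := q')) => //; apply: fle_meet. Qed.

Lemma upper_expI x z q q' u : u ⊑ upper z q' -> u ⊑ upper (rat_pow x q') q ->
  u ⊑ upper_exp x z q.
Proof. by move=> h1 h2; apply: (fjoinI (i := q')) => //; apply: fle_meet. Qed.

Lemma lower_expE x z q u c : u ⊑ lower_exp x z q ->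
  (forall q' v, v ⊑ u -> v ⊑ lower z q' -> v ⊑ lower (rat_pow x q') q -> v ⊑ c) ->
  u ⊑ c.
Proof.
move=> h k; apply: (fjoinE h) => q' v vu _ /fmeetP[h1 h2]; exact: (k q').
Qed.

Lemma upper_expE x z q u c : u ⊑ upper_exp x z q ->
  (forall q' v, v ⊑ u -> v ⊑ upper z q' -> v ⊑ upper (rat_pow x q') q -> v ⊑ c) ->
  u ⊑ c.
Proof.
move=> h k; apply: (fjoinE h) => q' v vu _ /fmeetP[h1 h2]; exact: (k q').
Qed.

Lemma lower_exp_neg x z q u : q <= 0 -> u ⊑ lower_exp x z q.
Proof.
move=> q0; apply: (@lower_bound _ z) => s v vu hs; apply: (lower_expI hs).
by apply: (lower_down q0); apply: forces_pos.
Qed.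

Definition rexp_ge1 x (x1 : ge1 x) z : real O.
Proof.
apply: (@mk_real O (lower_exp x z) (upper_exp x z)).
- by move=> u c k; apply: (k 0) (fle_refl _) _; apply: lower_exp_neg.
- move=> u c k; apply: (@upper_bound _ z) => s v vu hs.
  apply: (@upper_bound _ (rat_pow x s)) => r w wv hr.
  exact: (k r w (fle_trans _ wv vu) (upper_expI (fle_trans _ wv hs) hr)).
- move=> q q' u qq h; apply: (lower_expE h) => s v vu h1 h2.
  by apply: (lower_expI h1); apply: lower_down h2; apply: ltW.
- move=> q q' u qq h; apply: (upper_expE h) => s v vu h1 h2.
  by apply: (upper_expI h1); apply: upper_up h2; apply: ltW.
- move=> q u c h k; apply: (lower_expE h) => s v vu h1 h2.
  apply: (lower_open h2) => q' w wv qq h3.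
  exact: (k q' w (fle_trans _ wv vu) qq (lower_expI (fle_trans _ wv h1) h3)).
- move=> q u c h k; apply: (upper_expE h) => s v vu h1 h2.
  apply: (upper_open h2) => q' w wv qq h3.
  exact: (k q' w (fle_trans _ wv vu) qq (upper_expI (fle_trans _ wv h1) h3)).
- move=> q r u rq h1 h2.
  apply: (lower_expE h1) => a v vu za xa; down vu.
  apply: (upper_expE h2) => b w wv zb xb; down wv.
  apply: (cut_lt za zb) => ab.
  have xa' := lower_rat_pow_mono x1 (ltW ab) xa.
  by apply: (cut_lt xa' xb); rewrite ltNge rq.
- move=> q r u c qr k1 k2; case: (leP q 0) => q0.
    by apply: (k1 _ (fle_refl u)); apply: lower_exp_neg.
  have [s qs sr] := exists_mid qr; have s0 := lt_trans q0 qs.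
  have t1 : 1 < r / s by rewrite ltr_pdivlMr // mul1r.
  apply: (@upper_bound _ x) => M v vu hM.
  have [e e0 he] := small_rat_pow t1 hM.
  apply: (@approx _ z e v) => // a b w wv za zb ab.
  apply: (@locate _ (rat_pow x a) q s) => // w' w'w h.
    have wu := fle_trans _ w'w (fle_trans _ wv vu).
    exact: (k1 w' wu (lower_expI (fle_trans _ w'w za) h)).
  apply: (upper_open h) => s' w'' w''w' ss h'; apply: (upper_pos h') => s'0.
  have ww := fle_trans _ w''w' w'w; have wv' := fle_trans _ ww wv.
  have wu := fle_trans _ wv' vu.
  apply: (k2 w'' wu (upper_expI (fle_trans _ ww zb) _)).
  rewrite -[b](subrKC a) rat_powD.
  have t0 : 0 < r / s by lra.
  apply: (upper_mulI s'0 t0 _ h').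
    by rewrite mulrCA gtr_pMr ?(lt_trans s0) // ltr_pdivrMr // mul1r.
  exact: (upper_rat_pow_mono x1 (ltW ab) (fle_trans _ wv' he)).
Defined.

Definition exp_ge1 x (x1 : ge1 x) z : pos O.
Proof. by exists (rexp_ge1 x1 z); apply: lower_exp_neg. Defined.

Definition exp_le1 x (x1 : le1 x) z : pos O := exp_ge1 (le1_inv x1) (ropp z).

Lemma exp_ge1_eq x x' (x1 : ge1 x) (x1' : ge1 x') z z' :
  x = x' -> z = z' -> exp_ge1 x1 z = exp_ge1 x1' z'.
Proof. by move=> e e'; subst x' z'; congr exp_ge1; apply: proof_irrelevance. Qed.

Lemma exp_ge1_one x (x1 : ge1 x) z : x = one -> exp_ge1 x1 z = one.
Proof.
move=> e; apply: pos_eqL => q u h.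
  by apply: (lower_expE h) => q' v vu _; rewrite e rat_pow_one.
apply: (@lower_bound _ z) => q' v vu zq.
by apply: (lower_expI zq); rewrite e rat_pow_one; apply: fle_trans vu h.
Qed.

Lemma ge1_le1_one x : ge1 x -> le1 x -> x = one.
Proof.
move=> h1 h2; apply: pos_eqL => q u h.
  case: (ltP q 1) => q1; first exact: fpropI.
  by apply/fbotE/(fle_trans _ _ h2); apply: lower_down h.
apply: (fpropE h) => q1.
apply: (@locate _ x q 1) => // v vu hv.
by apply/fbotE/(fle_trans _ hv h1).
Qed.

End ExpGe1.

Section BaseChange.
Variables (O O' : frame) (f : frame_hom O O').

(* f is the inverse image of a map of spaces g, and [rpull x], [pull x] are the
   generalised points x o g. *)
Definition rpull (x : real O) : real O'.
Proof.
apply: (@Real O' (fun q => f (lower x q)) (fun r => f (upper x r))).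
- by rewrite -(fhom_join f) -(fhom_top f); apply/fhom_le/lower_inh.
- by rewrite -(fhom_join f) -(fhom_top f); apply/fhom_le/upper_inh.
- by move=> q; rewrite {1}lower_rounded (fhom_join f).
- by move=> q; rewrite {1}upper_rounded (fhom_join f).
- move=> q r rq; rewrite -fhom_meet -(fhom_bot f).
  by apply: fhom_le; apply: cut_disjoint.
- move=> q r rq; rewrite -fhom_cup -(fhom_top f).
  by apply: fhom_le; apply: cut_located.
Defined.

Definition pull (x : pos O) : pos O'.
Proof.
by exists (rpull x); rewrite /= -(fhom_top f); apply/fhom_le/pos_gt0.
Defined.

Lemma pull_one : pull one = one.
Proof. by apply/pos_eq/real_ext => q /=; rewrite fhom_prop. Qed.

Lemma rpull_opp z : rpull (ropp z) = ropp (rpull z).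
Proof. exact: real_ext. Qed.

Lemma fjoin_ext I (P : I -> Prop) (A B : I -> O') :
  (forall i, A i = B i) -> fjoin P A = fjoin P B.
Proof. by move=> h; congr fjoin; apply: functional_extensionality. Qed.

Lemma pull_mul x y : pull (mul x y) = mul (pull x) (pull y).
Proof.
by apply/pos_eq/real_ext => q /=; rewrite (fhom_join f); apply: fjoin_ext => -[a b];
  rewrite fhom_meet.
Qed.

Lemma pull_inv x : pull (inv x) = inv (pull x).
Proof. by apply/pos_eq/real_ext => q /=; rewrite (fhom_join f). Qed.

Lemma pull_npow x n : pull (npow x n) = npow (pull x) n.
Proof. by elim: n => [|n IHn]; rewrite ?pull_one // !npowS pull_mul IHn. Qed.

Lemma pull_root b (b0 : (0 < b)%N) x : pull (nroot b0 x) = nroot b0 (pull x).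
Proof. by apply/pos_eq/real_ext => q /=; rewrite (fhom_join f). Qed.

Lemma pull_rat_pow x q : pull (rat_pow x q) = rat_pow (pull x) q.
Proof.
by rewrite /rat_pow; case: ifP => _; rewrite ?pull_inv pull_root pull_npow.
Qed.

Lemma fhom_lower_rat_pow x p q :
  f (lower (rat_pow x p) q) = lower (rat_pow (pull x) p) q.
Proof. by rewrite -pull_rat_pow. Qed.

Lemma fhom_upper_rat_pow x p q :
  f (upper (rat_pow x p) q) = upper (rat_pow (pull x) p) q.
Proof. by rewrite -pull_rat_pow. Qed.

Lemma fhom_lower_exp x z q : f (lower_exp x z q) = lower_exp (pull x) (rpull z) q.
Proof.
rewrite (fhom_join f); apply: fjoin_ext => q'.
by rewrite fhom_meet fhom_lower_rat_pow.
Qed.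

Lemma fhom_upper_exp x z q : f (upper_exp x z q) = upper_exp (pull x) (rpull z) q.
Proof.
rewrite (fhom_join f); apply: fjoin_ext => q'.
by rewrite fhom_meet fhom_upper_rat_pow.
Qed.

Lemma pull_exp_ge1 x (x1 : ge1 x) (x1' : ge1 (pull x)) z :
  pull (exp_ge1 x1 z) = exp_ge1 x1' (rpull z).
Proof.
by apply/pos_eq/real_ext => q /=; rewrite ?fhom_lower_exp ?fhom_upper_exp.
Qed.

Lemma ge1_pull x : ge1 x -> ge1 (pull x).
Proof. by move=> h; rewrite /ge1 -(fhom_bot f); apply: fhom_le. Qed.

Lemma le1_pull x : le1 x -> le1 (pull x).
Proof. by move=> h; rewrite /le1 -(fhom_bot f); apply: fhom_le. Qed.

End BaseChange.

Lemma fle_cupl (O : frame) (a b : O) : a ⊑ a ⊔ b.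
Proof. exact/fcupl/fle_refl. Qed.

Lemma fle_cupr (O : frame) (a b : O) : b ⊑ a ⊔ b.
Proof. exact/fcupr/fle_refl. Qed.

(* the closed complement of the open U, as a stage: its opens are the a
   above U *)
Section ClosedComplement.
Variable O : frame.

Section Frame.
Variable U : O.
Implicit Types (a b c : {a : O | U ⊑ a}).

Definition closed_sup (S : {a : O | U ⊑ a} -> Prop) : {a : O | U ⊑ a} :=
  exist _ (U ⊔ fsup (fun d : O => exists2 b, S b & d = sval b)) (fle_cupl _ _).

Definition closed_meet a b : {a : O | U ⊑ a} :=
  exist _ (sval a ⊓ sval b) (fle_meet (proj2_sig a) (proj2_sig b)).

Definition closed_frame : frame.
Proof.
apply: (@Frame {a : O | U ⊑ a} (fun a b => sval a ⊑ sval b)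
  (exist _ ⊤ (fle_top U)) closed_meet closed_sup).
- by move=> a; apply: fle_refl.
- by move=> b a c; apply: fle_trans.
- move=> [a ha] [b hb] /= ab ba; have e := fle_anti ab ba.
  by subst b; f_equal; apply: proof_irrelevance.
- by move=> a; apply: fle_top.
- by move=> a b; apply: fmeet_lel.
- by move=> a b; apply: fmeet_ler.
- by move=> a b c; apply: fle_meet.
- by move=> S a Sa; apply: (fle_trans _ _ (fle_cupr _ _)); apply: fsup_ub; exists a.
- move=> S c h; apply: fle_lub; first exact: (proj2_sig c).
  by apply: fsup_lub => _ [b Sb ->]; apply: h.
- move=> a S /=; have [h1 h2] := fmeetP (fle_refl (sval a ⊓
    (U ⊔ fsup (fun d : O => exists2 b, S b & d = sval b)))).
  apply: (fcupE h2) => v vu hv; first exact: fcupl.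
  apply: fcupr; apply: (fle_trans _ (fle_meet (fle_trans _ vu h1) hv)).
  apply: (fle_trans _ (fmeet_sup _ _)).
  apply: fsup_lub => _ [_ [b Sb ->] ->]; apply: fsup_ub.
  by exists (closed_meet a b) => //; exists b.
Defined.

End Frame.

Definition closed_map (U V : O) (UV : U ⊑ V) (a : closed_frame U) : closed_frame V :=
  exist _ (V ⊔ sval a) (fle_cupl _ _).

Lemma closed_eq U (a b : closed_frame U) : sval a = sval b -> a = b.
Proof.
by case: a b => [a ha] [b hb] /= e; subst b; f_equal; apply: proof_irrelevance.
Qed.

Lemma fcup_meet (U a b : O) : U ⊔ (a ⊓ b) = (U ⊔ a) ⊓ (U ⊔ b).
Proof.
apply: feq_forces => u; split=> [h|/fmeetP[h1 h2]].
  apply: (fcupE h) => v vu hv; first by apply: fle_meet; apply: fcupl.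
  by have [h1 h2] := fmeetP hv; apply: fle_meet; apply: fcupr.
apply: (fcupE h1) => v vu hv; first exact: fcupl.
apply: (fcupE (fle_trans _ vu h2)) => w wv hw; first exact: fcupl.
by apply: fcupr; apply: fle_meet => //; apply: fle_trans wv hv.
Qed.

(* the inclusion of the complement of V in the complement of U *)
Definition closed_incl (U V : O) (UV : U ⊑ V) :
  frame_hom (closed_frame U) (closed_frame V).
Proof.
apply: (@FrameHom (closed_frame U) (closed_frame V) (closed_map UV)).
- by apply: closed_eq; apply: fle_anti; [apply: fle_top|apply: fle_cupr].
- by move=> a b; apply: closed_eq; apply: fcup_meet.
- move=> S; apply: closed_eq; apply: fle_anti => /=; apply: fle_lub.
  + exact: fle_cupl.
  + apply: fle_lub; first by apply: (fle_trans _ UV); apply: fle_cupl.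
    apply: fsup_lub => _ [b Sb ->]; apply: fcupr.
    apply: (fle_trans _ (fle_cupr V (sval b))); apply: fsup_ub.
    by exists (closed_map UV b) => //; exists b.
  + exact: fle_cupl.
  + apply: fsup_lub => _ [_ [b Sb ->] ->]; apply: fle_lub; first exact: fle_cupl.
    by apply: fcupr; apply: fcupr; apply: fsup_ub; exists b.
Defined.

(* the inclusion of the complement of U in the whole space *)
Definition closed_restr (U : O) : frame_hom O (closed_frame U).
Proof.
apply: (@FrameHom O (closed_frame U)
  (fun a => exist _ (U ⊔ a) (fle_cupl _ _) : closed_frame U)).
- by apply: closed_eq; apply: fle_anti; [apply: fle_top|apply: fle_cupr].
- by move=> a b; apply: closed_eq; apply: fcup_meet.
- move=> S; apply: closed_eq; apply: fle_anti => /=; apply: fle_lub.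
  + exact: fle_cupl.
  + apply: fsup_lub => b Sb; apply: fcupr.
    apply: (fle_trans _ (fle_cupr U b)); apply: fsup_ub.
    by exists (exist _ (U ⊔ b) (fle_cupl _ _)) => //; exists b.
  + exact: fle_cupl.
  + apply: fsup_lub => _ [_ [b Sb ->] ->]; apply: fle_lub; first exact: fle_cupl.
    by apply: fcupr; apply: fsup_ub.
Defined.

Lemma closed_bot (U : O) (a : closed_frame U) : sval a ⊑ U -> a ⊑ ⊥.
Proof. by move=> h; apply: (fle_trans _ h); apply: fle_cupl. Qed.

End ClosedComplement.

(* If the opens U and V are disjoint then the space is the pushout of their
   closed complements over the intersection of these. *)
Section Glue.
Variables (O : frame) (U V : O).
Hypothesis UV : U ⊓ V ⊑ ⊥.

Lemma patch_le (a b : O) :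
  closed_restr U a ⊑ closed_restr U b -> closed_restr V a ⊑ closed_restr V b ->
  a ⊑ b.
Proof.
move=> hU hV.
apply: (fcupE (fle_trans _ (fle_cupr U a) hU)) => v va hv //.
apply: (fcupE (fle_trans _ va (fle_trans _ (fle_cupr V a) hV))) => w wv hw //.
by apply: fbotE; apply: (fle_trans _ _ UV); apply: fle_meet => //; apply: fle_trans wv hv.
Qed.

Lemma patch_eq (a b : O) :
  closed_restr U a = closed_restr U b -> closed_restr V a = closed_restr V b ->
  a = b.
Proof. by move=> h1 h2; apply: fle_anti; apply: patch_le; rewrite ?h1 ?h2; apply: fle_refl. Qed.

Lemma patch_real (x y : real O) :
  rpull (closed_restr U) x = rpull (closed_restr U) y ->
  rpull (closed_restr V) x = rpull (closed_restr V) y -> x = y.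
Proof.
move=> h1 h2; apply: real_ext => q; apply: patch_eq.
- exact: (congr1 (fun z => lower z q) h1).
- exact: (congr1 (fun z => lower z q) h2).
- exact: (congr1 (fun z => upper z q) h1).
- exact: (congr1 (fun z => upper z q) h2).
Qed.

Lemma patch_pos (x y : pos O) :
  pull (closed_restr U) x = pull (closed_restr U) y ->
  pull (closed_restr V) x = pull (closed_restr V) y -> x = y.
Proof.
by move=> h1 h2; apply/pos_eq/patch_real;
  [exact: (congr1 (@pval _) h1)|exact: (congr1 (@pval _) h2)].
Qed.

Variables (z1 : pos (closed_frame U)) (z2 : pos (closed_frame V)).
Hypothesis compat :
  pull (closed_incl (fle_cupl U V)) z1 = pull (closed_incl (fle_cupr U V)) z2.

Lemma glue_restr (a : closed_frame U) (b : closed_frame V) :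
  closed_incl (fle_cupl U V) a = closed_incl (fle_cupr U V) b ->
  closed_restr U (sval a ⊓ sval b) = a /\ closed_restr V (sval a ⊓ sval b) = b.
Proof.
move=> /(congr1 sval) /= e.
have ha := fle_cupr (U ⊔ V) (sval a); have hb := fle_cupr (U ⊔ V) (sval b).
rewrite e in ha; rewrite -e in hb.
split; apply: closed_eq; apply: fle_anti => /=.
- apply: fle_lub; first exact: (proj2_sig a); exact: fmeet_lel.
- apply: (fcupE ha) => v va hv; last by apply: fcupr; apply: fle_meet.
  apply: (fcupE hv) => w wv hw; first exact: fcupl.
  apply: fcupr; apply: fle_meet; first exact: fle_trans wv va.
  exact: fle_trans hw (proj2_sig b).
- apply: fle_lub; first exact: (proj2_sig b); exact: fmeet_ler.
- apply: (fcupE hb) => v va hv; last by apply: fcupr; apply: fle_meet.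
  apply: (fcupE hv) => w wv hw; last exact: fcupl.
  apply: fcupr; apply: fle_meet; last exact: fle_trans wv va.
  exact: fle_trans hw (proj2_sig a).
Qed.

Definition glue_lower (q : rat) : O := sval (lower z1 q) ⊓ sval (lower z2 q).
Definition glue_upper (r : rat) : O := sval (upper z1 r) ⊓ sval (upper z2 r).

Lemma glue_lowerE q : closed_restr U (glue_lower q) = lower z1 q /\
  closed_restr V (glue_lower q) = lower z2 q.
Proof. by apply: glue_restr; exact: (congr1 (fun z : pos _ => lower z q) compat). Qed.

Lemma glue_upperE r : closed_restr U (glue_upper r) = upper z1 r /\
  closed_restr V (glue_upper r) = upper z2 r.
Proof. by apply: glue_restr; exact: (congr1 (fun z : pos _ => upper z r) compat). Qed.

Let lowerU q := (glue_lowerE q).1.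
Let lowerV q := (glue_lowerE q).2.
Let upperU q := (glue_upperE q).1.
Let upperV q := (glue_upperE q).2.

Definition rglue : real O.
Proof.
apply: (@Real O glue_lower glue_upper).
- apply: patch_le; rewrite fhom_top fhom_join.
    by rewrite (fjoin_ext _ lowerU); apply: lower_inh.
  by rewrite (fjoin_ext _ lowerV); apply: lower_inh.
- apply: patch_le; rewrite fhom_top fhom_join.
    by rewrite (fjoin_ext _ upperU); apply: upper_inh.
  by rewrite (fjoin_ext _ upperV); apply: upper_inh.
- move=> q; apply: patch_eq; rewrite fhom_join.
    by rewrite (fjoin_ext _ lowerU) lowerU lower_rounded.
  by rewrite (fjoin_ext _ lowerV) lowerV lower_rounded.
- move=> q; apply: patch_eq; rewrite fhom_join.
    by rewrite (fjoin_ext _ upperU) upperU upper_rounded.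
  by rewrite (fjoin_ext _ upperV) upperV upper_rounded.
- move=> q r rq; apply: patch_le; rewrite fhom_meet fhom_bot.
    by rewrite lowerU upperU; apply: cut_disjoint.
  by rewrite lowerV upperV; apply: cut_disjoint.
- move=> q r rq; apply: patch_le; rewrite fhom_top fhom_cup.
    by rewrite lowerU upperU; apply: cut_located.
  by rewrite lowerV upperV; apply: cut_located.
Defined.

Definition glue : pos O.
Proof.
exists rglue; apply: patch_le; rewrite fhom_top -[lower rglue 0]/(glue_lower 0).
  by rewrite lowerU; apply: pos_gt0.
by rewrite lowerV; apply: pos_gt0.
Defined.

Lemma pull_glueU : pull (closed_restr U) glue = z1.
Proof. by apply/pos_eq/real_ext => q; [apply: lowerU|apply: upperU]. Qed.

Lemma pull_glueV : pull (closed_restr V) glue = z2.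
Proof. by apply/pos_eq/real_ext => q; [apply: lowerV|apply: upperV]. Qed.

End Glue.

Section Exp.
Variables (O : frame) (x : pos O) (z : real O).

Lemma lt1_gt1_disjoint : upper x 1 ⊓ lower x 1 ⊑ ⊥.
Proof.
apply: (fle_trans _ (fle_meet (fmeet_ler _ _) (fmeet_lel _ _))).
exact: cut_disjoint.
Qed.

Lemma ge1_restr : ge1 (pull (closed_restr (upper x 1)) x).
Proof. by apply: closed_bot; apply: fle_lub; apply: fle_refl. Qed.

Lemma le1_restr : le1 (pull (closed_restr (lower x 1)) x).
Proof. by apply: closed_bot; apply: fle_lub; apply: fle_refl. Qed.

(* the restrictions of x^z to the closed parts x >= 1 and x <= 1 of the stage *)
Definition exp_on_ge1 : pos (closed_frame (upper x 1)) :=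
  exp_ge1 ge1_restr (rpull (closed_restr (upper x 1)) z).

Definition exp_on_le1 : pos (closed_frame (lower x 1)) :=
  exp_le1 le1_restr (rpull (closed_restr (lower x 1)) z).

Lemma closed_incl_restr (U V : O) (UV : U ⊑ V) a :
  closed_incl UV (closed_restr U a) = closed_restr V a.
Proof.
apply: closed_eq; apply: fle_anti => /=.
  apply: fle_lub; first exact: fle_cupl.
  by apply: fle_lub; [apply: (fle_trans _ UV); apply: fle_cupl|apply: fle_cupr].
apply: fle_lub; first exact: fle_cupl.
by apply: fcupr; apply: fle_cupr.
Qed.

Lemma pull_closed_incl (U V : O) (UV : U ⊑ V) y :
  pull (closed_incl UV) (pull (closed_restr U) y) = pull (closed_restr V) y.
Proof. by apply/pos_eq/real_ext => q; apply: closed_incl_restr. Qed.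

(* on the intersection x = 1, and both partial powers are 1 *)
Lemma exp_compat :
  pull (closed_incl (fle_cupl (upper x 1) (lower x 1))) exp_on_ge1 =
  pull (closed_incl (fle_cupr (upper x 1) (lower x 1))) exp_on_le1.
Proof.
have x1 : pull (closed_restr (upper x 1 ⊔ lower x 1)) x = one.
  apply: ge1_le1_one; apply: closed_bot; apply: fle_lub; try exact: fle_refl.
    exact: fle_cupl.
  exact: fle_cupr.
transitivity (one : pos (closed_frame (upper x 1 ⊔ lower x 1))).
  rewrite (pull_exp_ge1 _ (ge1_pull _ ge1_restr)); apply: exp_ge1_one.
  by rewrite pull_closed_incl.
rewrite (pull_exp_ge1 _ (ge1_pull _ (le1_inv le1_restr))); apply/esym/exp_ge1_one.
by rewrite pull_inv pull_closed_incl x1 inv_one.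
Qed.

Definition exp : pos O := glue lt1_gt1_disjoint exp_compat.

End Exp.

Section ExpTheory.
Variable O : frame.
Implicit Types (x : pos O) (z : real O).

Lemma exp_restr_ge1 x z :
  pull (closed_restr (upper x 1)) (exp x z) =
  exp_ge1 (ge1_restr x) (rpull (closed_restr (upper x 1)) z).
Proof. exact: pull_glueU. Qed.

Lemma exp_restr_le1 x z :
  pull (closed_restr (lower x 1)) (exp x z) =
  exp_le1 (le1_restr x) (rpull (closed_restr (lower x 1)) z).
Proof. exact: pull_glueV. Qed.

Lemma lower_glued_exp x z q : lower (exp x z) q =
  (upper x 1 ⊔ lower_exp x z q) ⊓ (lower x 1 ⊔ lower_exp (inv x) (ropp z) q).
Proof.
have e1 : lower (exp_on_ge1 x z) q = lower_exp (pull _ x) (rpull _ z) q := erefl.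
have e2 : lower (exp_on_le1 x z) q = lower_exp (inv (pull _ x)) (ropp (rpull _ z)) q := erefl.
rewrite -pull_inv -rpull_opp in e2.
rewrite -fhom_lower_exp in e1; rewrite -fhom_lower_exp in e2.
transitivity (sval (lower (exp_on_ge1 x z) q) ⊓ sval (lower (exp_on_le1 x z) q)) => //.
by rewrite e1 e2.
Qed.

Lemma upper_glued_exp x z q : upper (exp x z) q =
  (upper x 1 ⊔ upper_exp x z q) ⊓ (lower x 1 ⊔ upper_exp (inv x) (ropp z) q).
Proof.
have e1 : upper (exp_on_ge1 x z) q = upper_exp (pull _ x) (rpull _ z) q := erefl.
have e2 : upper (exp_on_le1 x z) q = upper_exp (inv (pull _ x)) (ropp (rpull _ z)) q := erefl.
rewrite -pull_inv -rpull_opp in e2.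
rewrite -fhom_upper_exp in e1; rewrite -fhom_upper_exp in e2.
transitivity (sval (upper (exp_on_ge1 x z) q) ⊓ sval (upper (exp_on_le1 x z) q)) => //.
by rewrite e1 e2.
Qed.

Lemma expE_ge1 x (x1 : ge1 x) z : exp x z = exp_ge1 x1 z.
Proof.
apply: (patch_pos (lt1_gt1_disjoint x)).
  by rewrite exp_restr_ge1 (pull_exp_ge1 x1 (ge1_restr x)).
have e : pull (closed_restr (lower x 1)) x = one.
  by apply: ge1_le1_one; [apply: ge1_pull|apply: le1_restr].
rewrite exp_restr_le1 (pull_exp_ge1 x1 (ge1_pull _ x1)) /exp_le1.
by rewrite !exp_ge1_one // e inv_one.
Qed.

Lemma expE_le1 x (x1 : le1 x) z : exp x z = exp_le1 x1 z.
Proof.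
have x1' := le1_inv x1.
apply: (patch_pos (lt1_gt1_disjoint x)).
  have e : pull (closed_restr (upper x 1)) x = one.
    by apply: ge1_le1_one; [apply: ge1_restr|apply: le1_pull].
  rewrite exp_restr_ge1 (pull_exp_ge1 (le1_inv x1) (ge1_pull _ (le1_inv x1))).
  by rewrite !exp_ge1_one // pull_inv e inv_one.
rewrite exp_restr_le1 (pull_exp_ge1 (le1_inv x1) (ge1_pull _ (le1_inv x1))).
by apply: exp_ge1_eq; rewrite ?pull_inv ?rpull_opp.
Qed.

End ExpTheory.

(* exp is natural in the stage, i.e. it is a map of spaces *)
Lemma pull_exp (O O' : frame) (f : frame_hom O O') (x : pos O) (z : real O) :
  pull f (exp x z) = exp (pull f x) (rpull f z).
Proof.
apply/pos_eq/real_ext => q.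
  transitivity (f (lower (exp x z) q)) => //; rewrite !lower_glued_exp.
  by rewrite fhom_meet !fhom_cup !fhom_lower_exp pull_inv rpull_opp.
transitivity (f (upper (exp x z) q)) => //; rewrite !upper_glued_exp.
by rewrite fhom_meet !fhom_cup !fhom_upper_exp pull_inv rpull_opp.
Qed.

(* Main.v *)
From mathcomp Require Import all_boot all_order all_algebra.
Require Import Defs.

Set Implicit Arguments.
Unset Strict Implicit.
Unset Printing Implicit Defensive.

Import Order.TTheory GRing.Theory Num.Theory.
Local Open Scope ring_scope.
Local Open Scope frame_scope.

(** For x, y >= 1 the base product law passes from rational exponents to real
    ones, since q |-> x^q and q |-> y^q are both increasing and so two rational
    exponents below zeta may be replaced by their maximum. An equation of points
    may be checked on the closed parts where each of x, y and xy is >= 1 or <= 1.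
    There, since inversion commutes with exponentiation, the law
    x^zeta y^zeta = (xy)^zeta can be rearranged into an instance of the law for
    two factors >= 1; for example for y <= 1 <= x and xy >= 1 one uses
    x = (xy) y^-1. *)

Section PositiveArithmetic.
Variable O : frame.
Implicit Types (x y : pos O) (q : rat) (z : real O).

Lemma invK x : inv (inv x) = x.
Proof. by apply: (@mulI _ (inv x)); rewrite mulV mulC mulV. Qed.

Lemma invM x y : inv (mul x y) = mul (inv x) (inv y).
Proof. by apply: (@mulI _ (mul x y)); rewrite mulV mulACA !mulV mul1. Qed.

Lemma mulK x y : mul (mul x y) (inv y) = x.
Proof. by rewrite -mulA mulV mulC mul1. Qed.

Lemma ge1_inv x : ge1 x -> le1 (inv x).
Proof.
move=> h; apply: (fjoinE (fle_refl _)) => r v _ [_ r1] hr.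
by apply: fle_trans h; apply: upper_up hr; rewrite mul1r in r1; exact: ltW.
Qed.

Lemma ge1_mul x y : ge1 x -> ge1 y -> ge1 (mul x y).
Proof.
move=> x1 y1; apply: (upper_mulE (fle_refl _)) => a b v _ a0 b0 ab ha hb.
(* As ab < 1, either a <= 1 or b <= ab < 1. *)
case: (leP a 1) => [a1|/ltW a1]; first exact: fle_trans (upper_up a1 ha) x1.
apply: fle_trans y1; apply: upper_up hb; apply: le_trans (ltW ab).
by rewrite ler_peMl // ltW.
Qed.

(** For q = (n - m)/d, multiplying the equations that characterise x^q and y^q gives the one that
    characterises (xy)^q. *)
Lemma rat_powM x y q : rat_pow (mul x y) q = mul (rat_pow x q) (rat_pow y q).
Proof.
have [n [m [d [d0 e]]]] := rat_repr q.
apply/esym/(rat_pow_uniq d0 e); rewrite !npowMl mulACA.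
by rewrite (rat_pow_spec x e) (rat_pow_spec y e).
Qed.

Lemma rat_powN x q : rat_pow x (- q) = inv (rat_pow x q).
Proof.
apply: (@mulI _ (rat_pow x q)); rewrite mulV -rat_powD subrr.
(* What remains is x^0 = 1, with the exponent written as (0 - 0)/1. *)
apply/esym/(@rat_pow_uniq _ _ _ _ 0 0 1) => //.
by rewrite /= !mul1.
Qed.

Lemma roppK z : ropp (ropp z) = z.
Proof. by apply: real_ext => q /=; rewrite opprK. Qed.

End PositiveArithmetic.

Section ExpGe1.
Variable O : frame.
Implicit Types (x y : pos O) (z : real O).

Lemma exp_ge1M x y (x1 : ge1 x) (y1 : ge1 y) (xy1 : ge1 (mul x y)) z :
  exp_ge1 xy1 z = mul (exp_ge1 x1 z) (exp_ge1 y1 z).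
Proof.
apply: pos_eqL => q u h.
  apply: (lower_expE h) => p v vu zp; rewrite rat_powM => hp.
  apply: (lower_mulE hp) => a b w wv a0 b0 qab ha hb.
  have zp' := fle_trans _ wv zp.
  by apply: (lower_mulI a0 b0 qab); [apply: lower_expI ha|apply: lower_expI hb].
apply: (lower_mulE h) => a b v vu a0 b0 qab ha hb.
apply: (lower_expE ha) => p w wv zp hp; down wv.
apply: (lower_expE hb) => p' w' w'w zp' hp'; down w'w.
apply: (@lower_expI _ _ _ _ (Num.max p p')).
  by case: (leP p p').
by rewrite rat_powM; apply: (lower_mulI a0 b0 qab);
  [apply: lower_rat_pow_mono hp|apply: lower_rat_pow_mono hp'];
  rewrite ?le_max ?lexx ?orbT.
Qed.

(** Negating the rational exponent exchanges p < -z with -p > z, and q < 1/w is witnessed by an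
    upper bound of w; so lower bounds of x^(-z) match upper bounds of x^z. *)
Lemma exp_ge1N x (x1 : ge1 x) z : exp_ge1 x1 (ropp z) = inv (exp_ge1 x1 z).
Proof.
apply: pos_eqL => q u h.
  apply: (lower_expE h) => p v vu zp; rewrite -[p]opprK rat_powN => hp.
  apply: (fjoinE hp) => r w wv qr hr; apply: (fjoinI qr).
  by apply: upper_expI hr; apply: fle_trans wv zp.
apply: (fjoinE h) => r v vu qr hr.
apply: (upper_expE hr) => p w wv zp hp.
apply: (@lower_expI _ _ _ _ (- p)); first by rewrite /= opprK.
by rewrite rat_powN; apply: (fjoinI qr).
Qed.

End ExpGe1.

(** The opens x < 1 and x > 1 are disjoint, so their closed complements jointly detect equality.
    Stating the premise for an arbitrary [f] lets the pulled-back points be generalised to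
    variables. *)
Lemma pos_eq_cases (O : frame) (x a b : pos O) :
  (forall (O' : frame) (f : frame_hom O O'),
     ge1 (pull f x) \/ le1 (pull f x) -> pull f a = pull f b) -> a = b.
Proof.
move=> h; apply: (patch_pos (lt1_gt1_disjoint x)); apply: h.
  by left; apply: ge1_restr.
by right; apply: le1_restr.
Qed.

Lemma exp_inv (O : frame) (x : pos O) (z : real O) :
  exp (inv x) z = inv (exp x z).
Proof.
apply: (pos_eq_cases (x := x)) => O' f; rewrite pull_exp !pull_inv pull_exp.
move: (pull f x) (rpull f z) => {f} {}x {}z [] x1.
  (* By definition the power of x^-1 <= 1 is ((x^-1)^-1)^(-z). *)
  rewrite (expE_ge1 x1) (expE_le1 (ge1_inv x1)) -(exp_ge1N x1).
  exact: exp_ge1_eq (invK x) _.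
rewrite (expE_le1 x1) (expE_ge1 (le1_inv x1)).
by rewrite -(exp_ge1N (le1_inv x1)) roppK.
Qed.

Lemma expM_ge1 (O : frame) (x y : pos O) (z : real O) : ge1 x -> ge1 y ->
  exp (mul x y) z = mul (exp x z) (exp y z).
Proof.
move=> x1 y1; rewrite (expE_ge1 (ge1_mul x1 y1)) (expE_ge1 x1) (expE_ge1 y1).
exact: exp_ge1M.
Qed.

Lemma expM_ge1_le1 (O : frame) (x y : pos O) (z : real O) : ge1 x -> le1 y ->
  exp (mul x y) z = mul (exp x z) (exp y z).
Proof.
move=> x1 y1; apply: (pos_eq_cases (x := mul x y)) => O' f.
rewrite !pull_mul !pull_exp !pull_mul.
move: (ge1_pull f x1) (le1_pull f y1) => {x1 y1}.
move: (pull f x) (pull f y) (rpull f z) => {f} {}x {}y {}z x1 y1 [] xy1.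
  have := expM_ge1 z xy1 (le1_inv y1); rewrite mulK exp_inv => ->.
  by rewrite -mulA (mulC (inv _)) mulV [RHS]mulC mul1.
(* For xy <= 1, use y^-1 = x (xy)^-1, where both factors are >= 1. *)
have := expM_ge1 z x1 (le1_inv xy1).
rewrite invM mulA mulV mul1 -invM !exp_inv => e.
by apply: (@mulI _ (inv (exp (mul x y) z))); rewrite mulA (mulC _ (exp x z)) -e
  mulC mulV mulC mulV.
Qed.

Lemma expM (O : frame) (x y : pos O) (z : real O) :
  exp (mul x y) z = mul (exp x z) (exp y z).
Proof.
apply: (pos_eq_cases (x := x)) => O1 f.
rewrite !pull_mul !pull_exp !pull_mul.
move: (pull f x) (pull f y) (rpull f z) => {f} {}x {}y {}z x1.
apply: (pos_eq_cases (x := y)) => O2 f.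
rewrite !pull_mul !pull_exp !pull_mul.
(* The alternative for [x] persists under pullback along the second [f]. *)
have {x1}: ge1 (pull f x) \/ le1 (pull f x).
  by case: x1; [left; apply: ge1_pull|right; apply: le1_pull].
move: (pull f x) (pull f y) (rpull f z) => {f} {}x {}y {}z [] x1 [] y1.
- exact: expM_ge1.
- exact: expM_ge1_le1.
- by rewrite mulC expM_ge1_le1 // mulC.
(* Both factors are <= 1: apply the law to their inverses, then invert. *)
- have := expM_ge1 z (le1_inv x1) (le1_inv y1).
  by rewrite -invM !exp_inv -invM => e; rewrite -[LHS]invK e invK.
Qed.

Theorem corollary3p10 (O : frame) :
  (forall (x y : pos O) (zeta : real O),
      exp (mul x y) zeta = mul (exp x zeta) (exp y zeta)) /\
  (forall zeta : real O, exp one zeta = one).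
Proof.
split; first exact: expM.
by move=> zeta; rewrite (expE_ge1 (ge1_one O)); apply: exp_ge1_one.
Qed.
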